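(* Let $(\mathcal M,g,J)$ be a 4-dimensional (pseudo)hermitian manifold, oriented so that $\mathcal N={\rm T}^{(1,0)}\mathcal M$ is selfdual, and let $\nabla^W$ be its canonical (pseudo)hermitian-Weyl connection, with Cotton tensor $A^W$. Assume that $$(\nabla^W_XA^W)(Y,X,Y)\equiv(\nabla^W_YA^W)(X,X,Y)\quad\text{for all vectors } X,Y\in\mathcal N={\rm T}^{(1,0)}\mathcal M .$$ Then the selfdual part of the Weyl tensor of $(\mathcal M,g)$ is algebraically special at every point of $\mathcal M$, with $J$ being the multiple principal hermitian structure (that is, $\mathcal N={\rm T}^{(1,0)}\mathcal M$ is a field of multiple principal totally null 2-planes).
   Context: A (pseudo)hermitian manifold $(\mathcal M,g,J)$ is a manifold with a real metric $g$ of Riemannian (resp. split) signature and an integrable complex structure $J$ with $g(JX,JY)=g(X,Y)$. Tensors are extended complex-multilinearly to ${\rm T}^{\mathbb C}\mathcal M$. Then $\mathcal N={\rm T}^{(1,0)}\mathcal M$ is totally null ($g_{|\mathcal N}\equiv0$), integrable, and $\mathcal N\cap\overline{\mathcal N}=0$. A totally null 2-plane is selfdual if $*(n_1\wedge n_2)=n_1\wedge n_2$ for its elements. Canonical (pseudo)hermitian-Weyl connection: the unique real torsionless connection $\nabla^W$ on $\mathcal M$ with $\nabla^WJ=0$ (equivalently $\nabla^W_X\mathcal N\subset\mathcal N$ for all $X$) and $\nabla^Wg=-B\otimes g$ for some real 1-form $B$; it exists on every 4-dimensional (pseudo)hermitian manifold. Its curvature is defined by $\tfrac12R^{W\,a}{}_{bcd}\theta^c\wedge\theta^d={\rm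 d}\Gamma^{W\,a}{}_b+\Gamma^{W\,a}{}_c\wedge\Gamma^{W\,c}{}_b$, where $\Gamma^{W\,a}{}_b$ are its connection 1-forms ($\nabla^W e_b=\Gamma^{W\,a}{}_b\otimes e_a$). Set $R^W_{ab}=R^{W\,c}{}_{acb}$, $R^W=g^{ab}R^W_{ab}$, $\mathsf P^W_{ab}=\tfrac12R^W_{ab}-\tfrac1{12}R^Wg_{ab}$, $A^W_{abc}=2\nabla^W_{[b}\mathsf P^W_{c]a}=\nabla^W_b\mathsf P^W_{ca}-\nabla^W_c\mathsf P^W_{ba}$, and $A^W(X,Y,Z)=A^W_{abc}X^aY^bZ^c$. Algebraic speciality: let $(m,p,n,k)$ be a local frame of ${\rm T}^{\mathbb C}\mathcal M$ with $g(m,p)=g(n,k)=1$, all other products of frame vectors zero, and $\mathcal N={\rm Span}_{\mathbb C}(m,k)$. With $C$ the Weyl tensor of $g$, a selfdual totally null plane ${\rm Span}_{\mathbb C}(m+zn,k-zp)$ is (multiple) principal if $z$ is a (multiple) root of the quartic $z\mapsto C(m+zn,k-zp,m+zn,k-zp)$. The selfdual part of the Weyl tensor is algebraically special at a point if a multiple principal selfdual plane exists there. $\mathcal N$ is multiple principal iff $\Psi_0=C(m,k,m,k)\equiv0$ and $\Psi_1=C(m,k,n,k)\equiv0$; then $J$ is called a multiple principal hermitian structure. *)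

(* Defs.v *)
From mathcomp Require Import all_boot all_order all_algebra.
From mathcomp Require Import all_classical all_reals all_analysis.
From mathcomp Require Import complex.

Set Implicit Arguments.
Unset Strict Implicit.
Unset Printing Implicit Defensive.

Import Order.TTheory GRing.Theory Num.Theory.
Import numFieldNormedType.Exports.

Local Open Scope classical_set_scope.
Local Open Scope ring_scope.
Local Open Scope complex_scope.

(** Tensor calculus is done in the classical way: a tensor field on a manifold
    is a family of component functions, one for each chart, related on the
    overlaps by the usual transformation laws. Components are functions of the
    coordinates [x : 'rV[R]_4] and are constrained only on the image of the
    chart. Tangent vectors (real or complex) are row vectors of components
    with respect to the coordinate frame. *)

(** * Partial derivatives and smoothness *)

Definition pd (R : realType) (a : 'I_4) (f : 'rV[R]_4 -> R) : 'rV[R]_4 -> R :=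
  fun x => 'D_(delta_mx 0 a) f x.

(** C^oo on an open set: every iterated partial derivative is Fréchet
    differentiable (in particular continuous) there. *)
Definition smooth_on (R : realType) (U : set 'rV[R]_4) (f : 'rV[R]_4 -> R) :=
  forall (s : seq 'I_4) (x : 'rV[R]_4), U x -> differentiable (foldr (@pd R) f s) x.

(** * Smooth 4-manifolds *)

(** [cinv] is the inverse of [cmap] on [cimg]; values outside are irrelevant. *)
Record chart (R : realType) (M : topologicalType) := Chart {
  cdom : set M;
  cimg : set 'rV[R]_4;
  cmap : M -> 'rV[R]_4;
  cinv : 'rV[R]_4 -> M;
  cdom_open : open cdom;
  cimg_open : open cimg;
  cmap_in : forall q, cdom q -> cimg (cmap q);
  cinv_in : forall x, cimg x -> cdom (cinv x);
  cmapK : forall q, cdom q -> cinv (cmap q) = q;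
  cinvK : forall x, cimg x -> cmap (cinv x) = x;
  cmap_continuous : {within cdom, continuous cmap};
  cinv_continuous : {within cimg, continuous cinv}
}.

(** [overlap c d] is the image under [c] of the common domain of [c] and [d]. *)
Definition overlap (R : realType) (M : topologicalType) (c d : chart R M) :
  set 'rV[R]_4 := [set x | cimg c x /\ cdom d (cinv c x)].

Definition transition (R : realType) (M : topologicalType) (c d : chart R M) :
  'rV[R]_4 -> 'rV[R]_4 := fun x => cmap d (cinv c x).

Record manifold4 (R : realType) := Manifold4 {
  carrier :> topologicalType;
  carrier_hausdorff : hausdorff_space carrier;
  carrier_second_countable : @second_countable carrier;
  chart_index : Type;
  atlas : chart_index -> chart R carrier;
  atlas_cover : forall q : carrier, exists i, cdom (atlas i) q;
  atlas_smooth : forall i j (a : 'I_4),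
    smooth_on (overlap (atlas i) (atlas j))
              (fun x => transition (atlas i) (atlas j) x 0 a)
}.

(** [jac i j x b a] is the derivative of the [a]-th [j]-coordinate with respect
    to the [b]-th [i]-coordinate; row vectors transform by [v |-> v *m jac]. *)
Definition jac (R : realType) (M : manifold4 R) (i j : chart_index M)
    (x : 'rV[R]_4) : 'M[R]_4 :=
  \matrix_(b, a) pd b (fun y => transition (atlas i) (atlas j) y 0 a) x.

(** * Tensor fields *)

Definition smooth_mx (R : realType) (U : set 'rV[R]_4) (m n : nat)
    (T : 'rV[R]_4 -> 'M[R]_(m, n)) :=
  forall a b, smooth_on U (fun x => T x a b).

Definition positive_definite (R : realType) (G : 'M[R]_4) : Prop :=
  forall v : 'rV[R]_4, v != 0 -> 0 < (v *m G *m v^T) 0 0.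

Definition split_signature (R : realType) (G : 'M[R]_4) : Prop :=
  exists2 Q : 'M[R]_4, Q \in unitmx &
    Q *m G *m Q^T = diag_mx (\row_(a < 4) (if (a < 2)%N then 1 else -1)).

(** A metric, of Riemannian or of split signature. *)
Record pseudo_metric (R : realType) (M : manifold4 R) := PseudoMetric {
  metric_comp :> chart_index M -> 'rV[R]_4 -> 'M[R]_4;
  metric_smooth : forall i, smooth_mx (cimg (atlas i)) (metric_comp i);
  metric_change : forall i j x, overlap (atlas i) (atlas j) x ->
    metric_comp i x =
      jac i j x *m metric_comp j (transition (atlas i) (atlas j) x)
                *m (jac i j x)^T;
  metric_sym : forall i x, cimg (atlas i) x ->
    (metric_comp i x)^T = metric_comp i x;
  metric_signature :
    (forall i x, cimg (atlas i) x -> positive_definite (metric_comp i x)) \/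
    (forall i x, cimg (atlas i) x -> split_signature (metric_comp i x))
}.

(** Nijenhuis tensor of J in coordinates: the [a]-th component of
    [J e_b, J e_c] - J [J e_b, e_c] - J [e_b, J e_c] - [e_b, e_c],
    where [J x b a] is the [a]-th component of [J e_b]. *)
Definition nijenhuis (R : realType) (J : 'rV[R]_4 -> 'M[R]_4) (a b c : 'I_4)
    (x : 'rV[R]_4) : R :=
  \sum_d (J x b d * pd d (fun y => J y c a) x
          - J x c d * pd d (fun y => J y b a) x
          - J x d a * pd b (fun y => J y c d) x
          + J x d a * pd c (fun y => J y b d) x).

(** An integrable almost complex structure; it acts on row vectors on the
    right, i.e. [J X] is [X *m J x]. *)
Record complex_structure (R : realType) (M : manifold4 R) := ComplexStructure {
  cs_comp :> chart_index M -> 'rV[R]_4 -> 'M[R]_4;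
  cs_smooth : forall i, smooth_mx (cimg (atlas i)) (cs_comp i);
  cs_change : forall i j x, overlap (atlas i) (atlas j) x ->
    cs_comp i x *m jac i j x =
      jac i j x *m cs_comp j (transition (atlas i) (atlas j) x);
  cs_square : forall i x, cimg (atlas i) x ->
    cs_comp i x *m cs_comp i x = - 1%:M;
  cs_integrable : forall i x, cimg (atlas i) x ->
    forall a b c, nijenhuis (cs_comp i) a b c x = 0
}.

(** g(JX, JY) = g(X, Y). *)
Definition hermitian_metric (R : realType) (M : manifold4 R)
    (g : pseudo_metric M) (J : complex_structure M) : Prop :=
  forall i x, cimg (atlas i) x -> J i x *m g i x *m (J i x)^T = g i x.

Record one_form (R : realType) (M : manifold4 R) := OneForm {
  form_comp :> chart_index M -> 'rV[R]_4 -> 'rV[R]_4;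
  form_smooth : forall i, smooth_mx (cimg (atlas i)) (form_comp i);
  form_change : forall i j x, overlap (atlas i) (atlas j) x ->
    form_comp i x =
      form_comp j (transition (atlas i) (atlas j) x) *m (jac i j x)^T
}.

(** An orientation: the sign of each coordinate frame. *)
Record orientation (R : realType) (M : manifold4 R) := Orientation {
  frame_sign :> chart_index M -> 'rV[R]_4 -> R;
  frame_sign_val : forall i x, cimg (atlas i) x ->
    frame_sign i x = 1 \/ frame_sign i x = -1;
  frame_sign_cst : forall i x, cimg (atlas i) x ->
    \forall y \near x, frame_sign i y = frame_sign i x;
  frame_sign_change : forall i j x, overlap (atlas i) (atlas j) x ->
    frame_sign i x =
      Num.sg (\det (jac i j x)) *
      frame_sign j (transition (atlas i) (atlas j) x)
}.

(** * Connections and curvature *)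

(** [G a b c x] is the coefficient Gamma^a_{bc}, with
    nabla_{e_c} e_b = Gamma^a_{bc} e_a: the last index is the direction of
    differentiation. *)
Definition coefficients (R : realType) :=
  'I_4 -> 'I_4 -> 'I_4 -> 'rV[R]_4 -> R.

Record connection (R : realType) (M : manifold4 R) := Connection {
  conn_comp :> chart_index M -> coefficients R;
  conn_smooth : forall i a b c, smooth_on (cimg (atlas i)) (conn_comp i a b c);
  conn_change : forall i j x, overlap (atlas i) (atlas j) x ->
    forall a b c,
    \sum_d conn_comp i d b c x * jac i j x d a =
      \sum_d \sum_e conn_comp j a d e (transition (atlas i) (atlas j) x)
                    * jac i j x b d * jac i j x c e
      + pd c (fun y => jac i j y b a) x
}.

Definition torsionless (R : realType) (M : manifold4 R) (D : connection M) :=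
  forall i x, cimg (atlas i) x -> forall a b c, D i a b c x = D i a c b x.

(** In covariant derivatives the first index is the direction of
    differentiation. *)

Definition nabla_cs (R : realType) (G : coefficients R)
    (J : 'rV[R]_4 -> 'M[R]_4) (c a b : 'I_4) (x : 'rV[R]_4) : R :=
  pd c (fun y => J y b a) x
  + \sum_e G a e c x * J x b e - \sum_e G e b c x * J x e a.

Definition nabla2 (R : realType) (G : coefficients R)
    (T : 'I_4 -> 'I_4 -> 'rV[R]_4 -> R) (c a b : 'I_4) (x : 'rV[R]_4) : R :=
  pd c (T a b) x
  - \sum_e G e a c x * T e b x - \sum_e G e b c x * T a e x.

Definition nabla3 (R : realType) (G : coefficients R)
    (T : 'I_4 -> 'I_4 -> 'I_4 -> 'rV[R]_4 -> R) (d a b c : 'I_4)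
    (x : 'rV[R]_4) : R :=
  pd d (T a b c) x
  - \sum_e G e a d x * T e b c x
  - \sum_e G e b d x * T a e c x
  - \sum_e G e c d x * T a b e x.

(** R^a_{bcd}, the components of d Gamma^a_b + Gamma^a_e /\ Gamma^e_b. *)
Definition curvature (R : realType) (G : coefficients R) (a b c d : 'I_4)
    (x : 'rV[R]_4) : R :=
  pd c (G a b d) x - pd d (G a b c) x
  + \sum_e (G a e c x * G e b d x - G a e d x * G e b c x).

Definition ricci (R : realType) (G : coefficients R) (a b : 'I_4)
    (x : 'rV[R]_4) : R :=
  \sum_c curvature G c a c b x.

Definition scalar_curvature (R : realType) (g : 'rV[R]_4 -> 'M[R]_4)
    (G : coefficients R) (x : 'rV[R]_4) : R :=
  \sum_a \sum_b invmx (g x) a b * ricci G a b x.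

Definition schouten (R : realType) (g : 'rV[R]_4 -> 'M[R]_4)
    (G : coefficients R) (a b : 'I_4) (x : 'rV[R]_4) : R :=
  2^-1 * ricci G a b x - 12^-1 * scalar_curvature g G x * g x a b.

Definition cotton (R : realType) (g : 'rV[R]_4 -> 'M[R]_4)
    (G : coefficients R) (a b c : 'I_4) (x : 'rV[R]_4) : R :=
  nabla2 G (schouten g G) b c a x - nabla2 G (schouten g G) c b a x.

Definition levi_civita (R : realType) (g : 'rV[R]_4 -> 'M[R]_4) :
    coefficients R := fun a b c x =>
  2^-1 * \sum_d invmx (g x) a d *
    (pd b (fun y => g y d c) x + pd c (fun y => g y d b) x
     - pd d (fun y => g y b c) x).

(** C_{abcd} = R_{abcd} - (g_{ac} P_{bd} - g_{ad} P_{bc}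
                           + g_{bd} P_{ac} - g_{bc} P_{ad}). *)
Definition weyl (R : realType) (g : 'rV[R]_4 -> 'M[R]_4) (a b c d : 'I_4)
    (x : 'rV[R]_4) : R :=
  let P a b := schouten g (levi_civita g) a b x in
  \sum_e g x a e * curvature (levi_civita g) e b c d x
  - (g x a c * P b d - g x a d * P b c + g x b d * P a c - g x b c * P a d).

(** The (pseudo)hermitian-Weyl connection: torsionless, nabla J = 0, and
    nabla g = - B (x) g for some 1-form B. *)
Definition hermitian_weyl (R : realType) (M : manifold4 R)
    (g : pseudo_metric M) (J : complex_structure M) (D : connection M) : Prop :=
  [/\ torsionless D,
      forall i x, cimg (atlas i) x ->
        forall a b c, nabla_cs (D i) (J i) c a b x = 0 &
      exists B : one_form M, forall i x, cimg (atlas i) x ->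
        forall a b c,
        nabla2 (D i) (fun a b y => g i y a b) c a b x = - B i x 0 c * g i x a b].

(** * Complex linear algebra in a complexified tangent space *)

(** Multilinear extension of a tensor with scalars in [R] along [f : R -> S]. *)
Definition eval4 (R S : nzRingType) (f : R -> S)
    (T : 'I_4 -> 'I_4 -> 'I_4 -> 'I_4 -> R) (X Y Z W : 'rV[S]_4) : S :=
  \sum_a \sum_b \sum_c \sum_d
    f (T a b c d) * X 0 a * Y 0 b * Z 0 c * W 0 d.

Definition eval4C (R : realType) (T : 'I_4 -> 'I_4 -> 'I_4 -> 'I_4 -> R)
    (X Y Z W : 'rV[R[i]]_4) : R[i] :=
  eval4 (fun t : R => t%:C) T X Y Z W.

Definition cform (R : realType) (G : 'M[R]_4) (X Y : 'rV[R[i]]_4) : R[i] :=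
  (X *m map_mx (fun t : R => t%:C) G *m Y^T) 0 0.

(** Complex planes are given as row spaces of matrices.  T^{(1,0)} is the
    [i]-eigenspace of the complexified J. *)
Definition T10 (R : realType) (J : 'M[R]_4) : 'M[R[i]]_4 :=
  eigenspace (map_mx (fun t : R => t%:C) J) ('i : R[i]).

Definition wedge (F : fieldType) (X Y : 'rV[F]_4) : 'M[F]_4 :=
  X^T *m Y - Y^T *m X.

(** Levi-Civita symbol. *)
Definition epsilon (R : realType) (a b c d : 'I_4) : R :=
  \det (\matrix_(r < 4, s < 4) (tnth [tuple a; b; c; d] r == s)%:R : 'M[R]_4).

Definition volume (R : realType) (G : 'M[R]_4) (o : R) (a b c d : 'I_4) : R :=
  o * Num.sqrt `|\det G| * epsilon R a b c d.

(** Hodge star on (complex) bivectors. *)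
Definition hodge (R : realType) (G : 'M[R]_4) (o : R) (F : 'M[R[i]]_4) :
    'M[R[i]]_4 :=
  \matrix_(a, b) (2^-1 * \sum_c \sum_d \sum_e \sum_h
    (invmx G a e * invmx G b h * volume G o e h c d)%:C * F c d).

Definition totally_null (R : realType) (G : 'M[R]_4) (P : 'M[R[i]]_4) : Prop :=
  forall X Y : 'rV[R[i]]_4, (X <= P)%MS -> (Y <= P)%MS -> cform G X Y = 0.

Definition selfdual (R : realType) (G : 'M[R]_4) (o : R) (P : 'M[R[i]]_4) :
    Prop :=
  forall X Y : 'rV[R[i]]_4, (X <= P)%MS -> (Y <= P)%MS ->
    hodge G o (wedge X Y) = wedge X Y.

(** A null frame (m, p, n, k) with Span(m, k) = N. *)
Definition adapted_frame (R : realType) (G : 'M[R]_4) (N : 'M[R[i]]_4)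
    (m p n k : 'rV[R[i]]_4) : Prop :=
  [/\ cform G m p = 1 /\ cform G n k = 1,
      [/\ cform G m m = 0, cform G p p = 0, cform G n n = 0 & cform G k k = 0],
      [/\ cform G m n = 0, cform G m k = 0, cform G p n = 0 & cform G p k = 0] &
      (col_mx m k :=: N)%MS].

(** The polynomial z |-> C(m + z n, k - z p, m + z n, k - z p). *)
Definition principal_quartic (R : realType)
    (C : 'I_4 -> 'I_4 -> 'I_4 -> 'I_4 -> R) (m p n k : 'rV[R[i]]_4) :
    {poly R[i]} :=
  let u := map_mx polyC m + 'X *: map_mx polyC n in
  let v := map_mx polyC k - 'X *: map_mx polyC p in
  eval4 (fun t : R => (t%:C)%:P) C u v u v.

(** Every number is a multiple root of the zero polynomial. *)
Definition multiple_root (F : fieldType) (q : {poly F}) (z : F) : Prop :=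
  ('X - z%:P) ^+ 2 %| q.

(** A plane is described by an adapted frame and a root parameter z in many
    ways; being multiple principal does not depend on the description. *)
Definition multiple_principal (R : realType) (G : 'M[R]_4) (o : R)
    (C : 'I_4 -> 'I_4 -> 'I_4 -> 'I_4 -> R) (N P : 'M[R[i]]_4) : Prop :=
  [/\ totally_null G P, selfdual G o P,
      (exists m p n k : 'rV[R[i]]_4, exists z : R[i],
        adapted_frame G N m p n k /\
        (col_mx (m + z *: n) (k - z *: p) :=: P)%MS) &
      (forall (m p n k : 'rV[R[i]]_4) (z : R[i]),
        adapted_frame G N m p n k ->
        (col_mx (m + z *: n) (k - z *: p) :=: P)%MS ->
        multiple_root (principal_quartic C m p n k) z)].

Definition algebraically_special (R : realType) (G : 'M[R]_4) (o : R)
    (C : 'I_4 -> 'I_4 -> 'I_4 -> 'I_4 -> R) (N : 'M[R[i]]_4) : Prop :=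
  exists P : 'M[R[i]]_4, multiple_principal G o C N P.

(* Main.v *)
(** Write [N] for T^{(1,0)}, [R] for the curvature of the Weyl connection,
    [P] for its Schouten tensor and [F = dB].  Then [R(X,Y)] preserves [N],
    because [nabla J = 0], and it is [F(X,Y)/2] plus a skew operator.
    The first Bianchi identity, paired with the null plane [N], shows that
    [R(X,Y)] acts on [N] as the scalar [F(X,Y)] when [X, Y] lie in [N], and
    that [Ric] restricted to [N] is skew, equal to [F].  As [N] is parallel,
    all covariant derivatives of [P] are skew on [N] too, so the condition on
    the Cotton tensor only sees the commutator of two covariant derivatives
    of [P]: for a basis [m, k] of [N] it says
      [0 = P(R(m,k) m, k) + P(m, R(m,k) k) = 2 F(m,k) P(m,k) = F(m,k)^2].
    Finally the Weyl tensor of [g] is [R - F g / 2] minus a Kulkarni-Nomizu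
    product of [g] with a tensor determined by [Ric] and [F], so the vanishing
    of [F] on [N] kills the two lowest coefficients of the principal quartic. *)
Require Import Defs.
From mathcomp Require Import all_boot all_order all_algebra.
From mathcomp Require Import all_classical all_reals all_analysis.
From mathcomp Require Import complex.
From mathcomp Require Import ring lra.

Set Implicit Arguments.
Unset Strict Implicit.
Unset Printing Implicit Defensive.

Import Order.TTheory GRing.Theory Num.Theory.
Import numFieldNormedType.Exports.

Local Open Scope classical_set_scope.
Local Open Scope ring_scope.
Local Open Scope complex_scope.

(** * Smooth functions on an open set *)

(** Two obstacles shape the proof. All tensors live in real coordinates, where no sections of [N]
    are at hand to be differentiated. Skewness on [N] is therefore traded, by [T10_invariant], for
    the real identity h = J h J^T of the symmetric part h. This identity holds on an open set,
    survives covariant differentiation because [J] is parallel, and is turned back into skewness on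
    [N] by [T10_null]. Secondly, the Weyl tensor is defined by the Levi-Civita connection, whereas
    the identities on [N] hold for the curvature of the Weyl connection. The comparison of the two
    curvatures only has to produce some tensor [Q] in the Kulkarni-Nomizu product: the Weyl tensor
    is trace-free, so a contraction afterwards determines [Q] by 2 Q = Ric - F/2 - t g. The scalar t
    is harmless, since only the values of [Q] on the null plane [N] enter the two lowest
    coefficients of the quartic. *)

Lemma near_eq_differentiable (R : numFieldType) (V W : normedModType R)
    (f g : V -> W) (x : V) :
  {near x, f =1 g} -> differentiable f x -> differentiable g x.
Proof.
move=> fg df; have -> : g = f + (g - f) by rewrite addrC subrK.
apply: differentiableD => //.
have gfx : (g - f) x = 0.
  by rewrite !fctE (nbhs_singleton fg) subrr.
(* [g - f] is zero near [x], so the zero map serves as its differential. *)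
have gfE : (g - f) \o shift x = cst ((g - f) x) + (\0 : V -> W) +o_ 0 id.
  apply/eqaddoP => e e0; move: fg; rewrite (near_shift 0) subr0 => fg.
  near=> h; rewrite gfx !fctE.
  have : f (h + x) = g (h + x).
    exact: (near fg h).
  by move=> ->; rewrite subrr addr0 subr0 normr0 mulr_ge0 // ltW.
have c0 : continuous (\0 : V -> W) by move=> y; exact: cvg_cst.
apply/diff_locallyP.
by rewrite (diff_unique c0 gfE).
Unshelve. all: by end_near. Qed.

Section PartialDerivatives.
Variable R : realType.
Implicit Types (a b c : 'I_4) (f g : 'rV[R]_4 -> R) (x y : 'rV[R]_4).

Lemma pdD a f g x : differentiable f x -> differentiable g x ->
  pd a (fun y => f y + g y) x = pd a f x + pd a g x.
Proof. by move=> df dg; apply: deriveD; exact: diff_derivable. Qed.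

Lemma pdN a f x : differentiable f x -> pd a (fun y => - f y) x = - pd a f x.
Proof. by move=> df; apply: deriveN; exact: diff_derivable. Qed.

Lemma pdB a f g x : differentiable f x -> differentiable g x ->
  pd a (fun y => f y - g y) x = pd a f x - pd a g x.
Proof. by move=> df dg; apply: deriveB; exact: diff_derivable. Qed.

Lemma pdM a f g x : differentiable f x -> differentiable g x ->
  pd a (fun y => f y * g y) x = pd a f x * g x + f x * pd a g x.
Proof.
move=> df dg; rewrite [LHS]deriveM; try exact: diff_derivable.
by rewrite addrC mulrC.
Qed.

Lemma pd_cst a (k : R) x : pd a (fun _ => k) x = 0.
Proof. exact: derive_cst. Qed.

Lemma pdV a f x : f x != 0 -> differentiable f x ->
  pd a (fun y => (f y)^-1) x = - (pd a f x * ((f x)^-1 * (f x)^-1)).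
Proof.
move=> f0 df; rewrite [LHS]deriveV//; last exact: diff_derivable.
by rewrite scaleNr mulrC -exprVn expr2.
Qed.

Lemma pd_sum a n (F : 'I_n -> 'rV[R]_4 -> R) x :
  (forall i, differentiable (F i) x) ->
  pd a (fun y => \sum_i F i y) x = \sum_i pd a (F i) x.
Proof.
move=> dF.
have -> : (fun y => \sum_i F i y) = \sum_i F i.
  by apply/funext => y; rewrite fct_sumE.
by apply: derive_sum => i; exact: diff_derivable.
Qed.

Section OpenSet.
Variable U : set 'rV[R]_4.
Hypothesis openU : open U.

Lemma near_open f g x : (forall y, U y -> f y = g y) -> U x -> {near x, f =1 g}.
Proof.
move=> fg Ux; have := open_nbhs_nbhs (conj openU Ux).
exact: filterS.
Qed.

Lemma pd_congr a f g x : (forall y, U y -> f y = g y) -> U x ->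
  pd a f x = pd a g x.
Proof. by move=> fg Ux; apply: near_eq_derive; exact: near_open. Qed.

(** [smooth_on] speaks of all iterated derivatives at once. Bounding their number gives an induction
    in which a closure property at order [n], applied to the first derivatives, yields it at order
    [n.+1]. *)
Definition smooth_upto n f :=
  forall s, (size s <= n)%N ->
  forall x, U x -> differentiable (foldr (@pd R) f s) x.

Lemma smooth_upto_on f : (forall n, smooth_upto n f) <-> smooth_on U f.
Proof.
split=> [sf s x Ux|sf n s _ x Ux]; last exact: sf.
exact: (sf (size s)).
Qed.

(** [foldr] applies the last entry of the list first, so the innermost derivative is split off with
    [rcons]. *)
Lemma smooth_uptoS n f : smooth_upto n.+1 f <->
  (forall x, U x -> differentiable f x) /\ (forall a, smooth_upto n (pd a f)).
Proof.
split=> [sf|[df sf] s].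
  split=> [x Ux|a s sn x Ux]; first exact: (sf [::]).
  by rewrite -foldr_rcons; apply: sf => //; rewrite size_rcons.
case/lastP: s => [|s a] sn x Ux; first exact: df.
by rewrite foldr_rcons; apply: sf => //; rewrite size_rcons in sn.
Qed.

Lemma smooth_upto0 f : smooth_upto 0 f <->
  (forall x, U x -> differentiable f x).
Proof. by split=> [sf x|df [|//] _ x Ux]; [exact: (sf [::])|exact: df]. Qed.

Lemma smooth_upto_diff n f x : smooth_upto n f -> U x -> differentiable f x.
Proof. by move=> sf; apply: (sf [::]). Qed.

Lemma smooth_uptoW n f : smooth_upto n.+1 f -> smooth_upto n f.
Proof. by move=> sf s sn; apply: sf; exact: leqW. Qed.

Lemma smooth_upto_congr n f g : (forall y, U y -> f y = g y) ->
  smooth_upto n f -> smooth_upto n g.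
Proof.
move=> fg sf s sn x Ux.
have H : forall y, U y -> foldr (@pd R) f s y = foldr (@pd R) g s y.
  by elim: s {sn} => //= a s IHs y Uy; exact: pd_congr.
by apply: near_eq_differentiable (sf s sn x Ux); exact: near_open.
Qed.

Lemma smooth_upto_cst n (k : R) : smooth_upto n (fun _ => k).
Proof.
elim: n k => [|n IHn] k.
  by apply/smooth_upto0 => x _; exact: differentiable_cst.
apply/smooth_uptoS; split=> [x _|a]; first exact: differentiable_cst.
by rewrite (_ : pd a _ = fun _ => 0)//; apply/funext => x; exact: pd_cst.
Qed.

Lemma smooth_uptoD n f g : smooth_upto n f -> smooth_upto n g ->
  smooth_upto n (fun y => f y + g y).
Proof.
have dD x : differentiable f x -> differentiable g x ->
    differentiable (fun y => f y + g y) x by exact: differentiableD.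
elim: n f g dD => [|n IHn] f g dD.
  by move=> /smooth_upto0 sf /smooth_upto0 sg; apply/smooth_upto0; auto.
move=> /smooth_uptoS[df sf] /smooth_uptoS[dg sg]; apply/smooth_uptoS.
split=> [|a]; first by auto.
apply: (@smooth_upto_congr _ (fun y => pd a f y + pd a g y)).
  by move=> y Uy; rewrite pdD//; auto.
by apply: IHn => // x; exact: differentiableD.
Qed.

Lemma smooth_uptoN n f : smooth_upto n f -> smooth_upto n (fun y => - f y).
Proof.
elim: n f => [|n IHn] f.
  move=> /smooth_upto0 sf; apply/smooth_upto0 => x Ux.
  exact: differentiableN (sf x Ux).
move=> /smooth_uptoS[df sf]; apply/smooth_uptoS; split=> [x Ux|a].
  exact: differentiableN (df x Ux).
apply: (@smooth_upto_congr _ (fun y => - pd a f y)); last exact: IHn.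
by move=> y Uy; rewrite pdN//; exact: df.
Qed.

Lemma smooth_uptoM n f g : smooth_upto n f -> smooth_upto n g ->
  smooth_upto n (fun y => f y * g y).
Proof.
elim: n f g => [|n IHn] f g.
  move=> /smooth_upto0 sf /smooth_upto0 sg; apply/smooth_upto0 => x Ux.
  exact: differentiableM (sf x Ux) (sg x Ux).
move=> sf' sg'; have := sf'; have := sg'.
move=> /smooth_uptoS[dg sg] /smooth_uptoS[df sf]; apply/smooth_uptoS.
split=> [x Ux|a]; first exact: differentiableM (df x Ux) (dg x Ux).
apply: (@smooth_upto_congr _ (fun y => pd a f y * g y + f y * pd a g y)).
  by move=> y Uy; rewrite pdM//; auto.
by apply: smooth_uptoD; apply: IHn => //; exact: smooth_uptoW.
Qed.

Lemma smooth_uptoV n f : (forall x, U x -> f x != 0) -> smooth_upto n f ->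
  smooth_upto n (fun y => (f y)^-1).
Proof.
move=> f0; elim: n => [|n IHn].
  move=> /smooth_upto0 sf; apply/smooth_upto0 => x Ux.
  exact: differentiableV (sf x Ux) (f0 x Ux).
move=> sf'; have := sf'; move=> /smooth_uptoS[df sf]; apply/smooth_uptoS.
split=> [x Ux|a]; first exact: differentiableV (df x Ux) (f0 x Ux).
have sV := IHn (smooth_uptoW sf').
apply: (@smooth_upto_congr _ (fun y => - (pd a f y * ((f y)^-1 * (f y)^-1)))).
  by move=> y Uy; rewrite pdV//; auto.
by apply: smooth_uptoN; do 2! apply: smooth_uptoM => //.
Qed.

Lemma smooth_onP f : smooth_on U f <->
  (forall x, U x -> differentiable f x) /\ (forall a, smooth_on U (pd a f)).
Proof.
split=> [/smooth_upto_on sf|[df sf]].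
  split=> [x|a]; first exact: (smooth_upto_diff (sf 0%N)).
  by apply/smooth_upto_on => n; have /smooth_uptoS[_] := sf n.+1; apply.
apply/smooth_upto_on => -[|n]; first exact/smooth_upto0.
by apply/smooth_uptoS; split=> // a; have /smooth_upto_on := sf a; apply.
Qed.

Lemma smooth_on_diff f x : smooth_on U f -> U x -> differentiable f x.
Proof. by move=> /smooth_onP[df _]; exact: df. Qed.

Lemma smooth_on_pd a f : smooth_on U f -> smooth_on U (pd a f).
Proof. by move=> /smooth_onP[]. Qed.

Lemma smooth_on_cst (k : R) : smooth_on U (fun _ => k).
Proof. by apply/smooth_upto_on => n; exact: smooth_upto_cst. Qed.

Lemma smooth_onD f g : smooth_on U f -> smooth_on U g ->
  smooth_on U (fun y => f y + g y).
Proof.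
move=> /smooth_upto_on sf /smooth_upto_on sg.
by apply/smooth_upto_on => n; exact: smooth_uptoD.
Qed.

Lemma smooth_onN f : smooth_on U f -> smooth_on U (fun y => - f y).
Proof.
move=> /smooth_upto_on sf.
by apply/smooth_upto_on => n; exact: smooth_uptoN.
Qed.

Lemma smooth_onB f g : smooth_on U f -> smooth_on U g ->
  smooth_on U (fun y => f y - g y).
Proof. by move=> sf sg; apply: smooth_onD => //; exact: smooth_onN. Qed.

Lemma smooth_onM f g : smooth_on U f -> smooth_on U g ->
  smooth_on U (fun y => f y * g y).
Proof.
move=> /smooth_upto_on sf /smooth_upto_on sg.
by apply/smooth_upto_on => n; exact: smooth_uptoM.
Qed.

Lemma smooth_onV f : (forall x, U x -> f x != 0) -> smooth_on U f ->
  smooth_on U (fun y => (f y)^-1).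
Proof.
move=> f0 /smooth_upto_on sf.
by apply/smooth_upto_on => n; exact: smooth_uptoV.
Qed.

Lemma smooth_on_congr f g : (forall y, U y -> f y = g y) ->
  smooth_on U f -> smooth_on U g.
Proof.
move=> fg /smooth_upto_on sf.
by apply/smooth_upto_on => n; exact: smooth_upto_congr (sf n).
Qed.

Lemma smooth_on_sum (I : Type) (r : seq I) (P : pred I)
    (F : I -> 'rV[R]_4 -> R) :
  (forall i, smooth_on U (F i)) ->
  smooth_on U (fun y => \sum_(i <- r | P i) F i y).
Proof.
move=> sF; elim: r => [|i r IHr].
  by under eq_fun do rewrite big_nil; exact: smooth_on_cst.
under eq_fun do rewrite big_cons.
by case: (P i) => //; exact: smooth_onD.
Qed.

Lemma smooth_on_prod (I : Type) (r : seq I) (P : pred I)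
    (F : I -> 'rV[R]_4 -> R) :
  (forall i, smooth_on U (F i)) ->
  smooth_on U (fun y => \prod_(i <- r | P i) F i y).
Proof.
move=> sF; elim: r => [|i r IHr].
  by under eq_fun do rewrite big_nil; exact: smooth_on_cst.
under eq_fun do rewrite big_cons.
by case: (P i) => //; exact: smooth_onM.
Qed.

Lemma smooth_det n (T : 'rV[R]_4 -> 'M[R]_n) :
  smooth_mx U T -> smooth_on U (fun y => \det (T y)).
Proof.
move=> sT; apply: smooth_on_sum => s; apply: smooth_onM.
  exact: smooth_on_cst.
by apply: smooth_on_prod => i; exact: sT.
Qed.

Lemma smooth_invmx n (T : 'rV[R]_4 -> 'M[R]_n) :
  (forall x, U x -> T x \in unitmx) -> smooth_mx U T ->
  smooth_mx U (fun y => invmx (T y)).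
Proof.
move=> uT sT a b.
(* Cramer's rule: the entries of the inverse are cofactors divided by the determinant. *)
apply: (@smooth_on_congr
  (fun y => (\det (T y))^-1 * ((-1) ^+ (b + a) * \det (row' b (col' a (T y)))))).
  by move=> y Uy; rewrite /invmx uT// !mxE.
apply: smooth_onM.
  apply: smooth_onV; last exact: smooth_det.
  by move=> x Ux; have := uT x Ux; rewrite unitmxE unitfE.
apply: smooth_onM; first exact: smooth_on_cst.
apply: smooth_det => i j; under eq_fun do rewrite !mxE; exact: sT.
Qed.

End OpenSet.
End PartialDerivatives.

(** * Symmetry of second partial derivatives *)

Section Schwarz.
Variables (R : realType) (V : normedModType R).
Implicit Types (f : V -> R) (u v x y : V).

Lemma is_derive_line f u y (s : R) : differentiable f (y + s *: u) ->
  is_derive s 1 (fun r : R => f (y + r *: u)) ('D_u f (y + s *: u)).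
Proof.
move=> df; have dfu : derivable f (y + s *: u) u by exact: diff_derivable.
have E : (fun h : R => h^-1 *: (((fun r : R => f (y + r *: u)) \o shift s) (h *: 1)
           - f (y + s *: u)))
       = (fun h : R => h^-1 *: ((f \o shift (y + s *: u)) (h *: u) - f (y + s *: u))).
  apply/funext => h; congr (_ *: (f _ - _)).
  by rewrite /= [h *: 1]mulr1 scalerDl addrCA.
by split; rewrite /derivable /derive E.
Qed.

Lemma mvt_line f u y (h : R) : 0 < h ->
  (forall s, 0 <= s <= h -> differentiable f (y + s *: u)) ->
  exists2 s, 0 <= s <= h & f (y + h *: u) - f y = h * 'D_u f (y + s *: u).
Proof.
move=> h0 df.
have dl s : s \in `[0, h] -> is_derive s 1 (fun r : R => f (y + r *: u))
    ('D_u f (y + s *: u)).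
  by rewrite in_itv /= => sh; exact/is_derive_line/df.
pose F (r : R) : R := f (y + r *: u).
pose F' (r : R) : R := 'D_u f (y + r *: u).
have dF s : s \in `]0, h[ -> is_derive s 1 F (F' s).
  by move=> /subset_itv_oo_cc; exact: dl.
have cF : {within `[0, h], continuous F}.
  by apply: derivable_within_continuous => s /dl [].
have [s] := MVT h0 dF cF.
rewrite in_itv /= => /andP[s0 sh]; rewrite /F /F' scale0r addr0 subr0 mulrC => fE.
by exists s => //; rewrite !ltW.
Qed.

(** Two mean value theorems for the second difference of [f] over a parallelogram: along [u] for the
    first difference [phi] in direction [v], then along [v] for ['D_u f]. *)
Lemma mvt_square f u v x (h : R) : 0 < h ->
  (forall s t, 0 <= s <= h -> 0 <= t <= h ->
    differentiable f (x + s *: u + t *: v) /\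
    differentiable ('D_u f) (x + s *: u + t *: v)) ->
  exists s t, [/\ 0 <= s <= h, 0 <= t <= h &
    f (x + h *: u + h *: v) - f (x + h *: u) - f (x + h *: v) + f x =
    h * (h * 'D_v ('D_u f) (x + s *: u + t *: v))].
Proof.
move=> h0 df; have h00 : 0 <= (0 : R) <= h by rewrite lexx ltW.
have hh : 0 <= h <= h by rewrite lexx ltW.
pose phi y := f (y + h *: v) - f y.
have dphi s : 0 <= s <= h -> differentiable phi (x + s *: u).
  move=> sh; apply: differentiableB.
    apply: (@differentiable_comp _ _ _ _ (fun y => y + h *: v)).
      by apply: differentiableD => //; exact: differentiable_cst.
    by have [] := df s h sh hh.
  by have [] := df s 0 sh h00; rewrite scale0r addr0.
have [s sh phiE] := mvt_line h0 dphi.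
have [|t th tE] := @mvt_line ('D_u f) v (x + s *: u) h h0.
  by move=> t th; have [] := df s t sh th.
exists s, t; split=> //; rewrite -tE.
have <- : 'D_u phi (x + s *: u) = 'D_u f (x + s *: u + h *: v) - 'D_u f (x + s *: u).
  rewrite [LHS]deriveB; last 2 first.
  - apply: diff_derivable; apply: (@differentiable_comp _ _ _ _ (fun y => y + h *: v)).
      by apply: differentiableD => //; exact: differentiable_cst.
    by have [] := df s h sh hh.
  - apply: diff_derivable.
    by have [] := df s 0 sh h00; rewrite scale0r addr0.
  congr (_ - _); rewrite /derive; congr (lim _).
  suff -> : (fun r : R => r^-1 *:
      ((f \o (fun y => y + h *: v) \o shift (x + s *: u)) (r *: u)
       - f (x + s *: u + h *: v))) =
    (fun r : R => r^-1 *: ((f \o shift (x + s *: u + h *: v)) (r *: u)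
      - f (x + s *: u + h *: v))) by [].
  by apply/funext => r /=; rewrite -addrA.
by rewrite -phiE /phi; ring.
Qed.

End Schwarz.

(** The second difference of [mvt_square] is symmetric in the two directions, so one mixed
    derivative at some point of a small parallelogram equals the other one at a second point.
    Continuity of both at [x] closes the gap. *)
Lemma pd_comm (R : realType) (U : set 'rV[R]_4) (f : 'rV[R]_4 -> R) (a b : 'I_4)
    (x : 'rV[R]_4) : open U -> smooth_on U f -> U x ->
  pd a (pd b f) x = pd b (pd a f) x.
Proof.
move=> oU sf Ux; pose u : 'rV[R]_4 := delta_mx 0 a; pose v : 'rV[R]_4 := delta_mx 0 b.
apply/eqP; rewrite -subr_eq0 -normr_le0; apply/ler_addgt0Pr => e e0; rewrite add0r.
have cont c d : \forall y \near x, `|pd c (pd d f) x - pd c (pd d f) y| < e / 2.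
  have /differentiable_continuous : differentiable (pd c (pd d f)) x.
    by apply: (smooth_on_diff (U := U)) => //; do 2! apply: smooth_on_pd.
  by move=> /cvgrPdist_lt; apply; rewrite divr_gt0.
have /nbhs_ballP[r /= r0 rU] : \forall y \near x, [/\ U y,
    `|pd a (pd b f) x - pd a (pd b f) y| < e / 2 &
    `|pd b (pd a f) x - pd b (pd a f) y| < e / 2].
  have nU := open_nbhs_nbhs (conj oU Ux).
  have cab := cont a b; have cba := cont b a.
  by apply: filterS3 nU cab cba => y Uy ab ba; split.
(* Points of the parallelogram are at distance at most [h * N], that is [r / 2], from [x]; the
   summand 1 makes [N] visibly positive. *)
pose N := `|u| + `|v| + 1; have N0 : 0 < N by rewrite ltr_wpDl// addr_ge0.
pose h := r / 2 / N; have h0 : 0 < h by rewrite !divr_gt0.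
have inb s t : 0 <= s <= h -> 0 <= t <= h -> ball x r (x + s *: u + t *: v).
  move=> /andP[s0 sh] /andP[t0 th].
  rewrite -ball_normE /ball_ /= opprD addrA opprD addrA subrr sub0r -opprD normrN.
  apply: (le_lt_trans (ler_normD _ _)); rewrite !normrZ !ger0_norm//.
  apply: (@le_lt_trans _ _ (h * N)).
    rewrite /N -addrA mulrDr lerD ?ler_wpM2r// (le_trans (y := h * `|v|))// ?ler_wpM2r//.
    by rewrite ler_wpM2l ?ltW// ltrDl.
  rewrite /h -mulrA mulVf ?gt_eqF// mulr1; lra.
have diffs s t : 0 <= s <= h -> 0 <= t <= h ->
    forall c, differentiable f (x + s *: u + t *: v) /\
    differentiable (pd c f) (x + s *: u + t *: v).
  move=> sh th c; have [Uy _ _] := rU _ (inb s t sh th).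
  split; first exact: (smooth_on_diff sf).
  by apply: (smooth_on_diff _ Uy); exact: smooth_on_pd.
have [s [t [sh th E1]]] := mvt_square h0 (fun s t sh th => diffs s t sh th a).
have diffs' : forall t s, 0 <= t <= h -> 0 <= s <= h ->
    differentiable f (x + t *: v + s *: u) /\
    differentiable (pd b f) (x + t *: v + s *: u).
  by move=> t' s' th' sh'; rewrite addrAC; exact: diffs.
have [t' [s' [th' sh' E2]]] := mvt_square h0 diffs'.
rewrite (addrAC x (h *: v)) (addrAC x (t' *: v)) in E2.
have [_ _ B1] := rU _ (inb s t sh th).
have [_ B2 _] := rU _ (inb s' t' sh' th').
have E : pd b (pd a f) (x + s *: u + t *: v) = pd a (pd b f) (x + s' *: u + t' *: v).
  have hn0 : h != 0 by rewrite gt_eqF.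
  apply: (mulfI hn0); apply: (mulfI hn0); apply: (etrans (esym E1)); apply: etrans E2.
  by rewrite -!addrA; congr (_ + _); rewrite addrCA.
move: E B1 B2; move: (x + s *: u + t *: v) (x + s' *: u + t' *: v) => y z ->.
move: (pd a (pd b f) x) (pd b (pd a f) x) (pd a (pd b f) z) => p q r1.
rewrite !ltr_distl ler_distl => /andP[l1 u1] /andP[l2 u2].
by apply/andP; clear -l1 u1 l2 u2; split; lra.
Qed.

(** * Matrix-valued functions and covariant derivatives *)

(* Otherwise unification unfolds partial derivatives down to limits. *)
Opaque pd.

Section LinearEntries.
Variables (R : pzRingType) (m n : nat).
Implicit Types A B : 'M[R]_(m, n).

Lemma addmxE A B i j : (A + B) i j = A i j + B i j.
Proof. exact: mxE. Qed.

Lemma oppmxE A i j : (- A) i j = - A i j.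
Proof. exact: mxE. Qed.

Lemma scalemxE k A i j : (k *: A) i j = k * A i j.
Proof. exact: mxE. Qed.

End LinearEntries.

Definition linmxE := (addmxE, oppmxE, scalemxE).

(** Both sides are expanded into sums of matrix products, which are then
    compared as atoms. *)
Ltac mxlinear :=
  rewrite ?(mulmxDl, mulmxDr, mulmxBl, mulmxBr, mulmxN, mulNmx,
            =^~ scalemxAl, =^~ scalemxAr, mulmxA, mul1mx, mulmx1);
  let i := fresh "i" in let j := fresh "j" in
  apply/matrixP => i j; rewrite ?linmxE; ring.

Section MatrixDerivatives.
Variable R : realType.
Implicit Types (a b c d : 'I_4) (x y : 'rV[R]_4).

Definition pdmx m n c (T : 'rV[R]_4 -> 'M[R]_(m, n)) x : 'M[R]_(m, n) :=
  \matrix_(a, b) pd c (fun y => T y a b) x.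

Lemma pdmxE m n c (T : 'rV[R]_4 -> 'M[R]_(m, n)) x i j :
  pdmx c T x i j = pd c (fun y => T y i j) x.
Proof. exact: mxE. Qed.

Variable U : set 'rV[R]_4.
Hypothesis openU : open U.

Lemma smooth_mxD m n (S T : 'rV[R]_4 -> 'M[R]_(m, n)) :
  smooth_mx U S -> smooth_mx U T -> smooth_mx U (fun y => S y + T y).
Proof. by move=> sS sT a b; under eq_fun do rewrite mxE; exact: smooth_onD. Qed.

Lemma smooth_mxN m n (T : 'rV[R]_4 -> 'M[R]_(m, n)) :
  smooth_mx U T -> smooth_mx U (fun y => - T y).
Proof. by move=> sT a b; under eq_fun do rewrite mxE; exact: smooth_onN. Qed.

Lemma smooth_mxB m n (S T : 'rV[R]_4 -> 'M[R]_(m, n)) :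
  smooth_mx U S -> smooth_mx U T -> smooth_mx U (fun y => S y - T y).
Proof. by move=> sS sT; apply: smooth_mxD => //; exact: smooth_mxN. Qed.

Lemma smooth_mxZ m n (k : 'rV[R]_4 -> R) (T : 'rV[R]_4 -> 'M[R]_(m, n)) :
  smooth_on U k -> smooth_mx U T -> smooth_mx U (fun y => k y *: T y).
Proof. by move=> sk sT a b; under eq_fun do rewrite mxE; exact: smooth_onM. Qed.

Lemma smooth_mxM m n p (S : 'rV[R]_4 -> 'M[R]_(m, n))
    (T : 'rV[R]_4 -> 'M[R]_(n, p)) :
  smooth_mx U S -> smooth_mx U T -> smooth_mx U (fun y => S y *m T y).
Proof.
move=> sS sT a b; under eq_fun do rewrite mxE.
by apply: smooth_on_sum => // e; exact: smooth_onM.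
Qed.

Lemma smooth_mx_tr m n (T : 'rV[R]_4 -> 'M[R]_(m, n)) :
  smooth_mx U T -> smooth_mx U (fun y => (T y)^T).
Proof. by move=> sT a b; under eq_fun do rewrite mxE; exact: sT. Qed.

Lemma smooth_mx_cst m n (A : 'M[R]_(m, n)) : smooth_mx U (fun=> A).
Proof. by move=> a b; exact: smooth_on_cst. Qed.

Lemma smooth_pdmx m n c (T : 'rV[R]_4 -> 'M[R]_(m, n)) :
  smooth_mx U T -> smooth_mx U (pdmx c T).
Proof.
by move=> sT a b; under eq_fun do rewrite mxE; exact: smooth_on_pd.
Qed.

Lemma smooth_mx_diff m n (T : 'rV[R]_4 -> 'M[R]_(m, n)) x i j :
  smooth_mx U T -> U x -> differentiable (fun y => T y i j) x.
Proof. by move=> sT; apply: smooth_on_diff; exact: sT. Qed.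

Lemma pdmx_congr m n c (S T : 'rV[R]_4 -> 'M[R]_(m, n)) x :
  (forall y, U y -> S y = T y) -> U x -> pdmx c S x = pdmx c T x.
Proof.
move=> ST Ux; apply/matrixP => a b; rewrite !mxE.
by apply: (pd_congr openU) => // y Uy; rewrite ST.
Qed.

Lemma pdmx_cst m n c (A : 'M[R]_(m, n)) x : pdmx c (fun=> A) x = 0.
Proof. by apply/matrixP => a b; rewrite !mxE pd_cst. Qed.

Lemma pdmx_tr m n c (T : 'rV[R]_4 -> 'M[R]_(m, n)) x :
  pdmx c (fun y => (T y)^T) x = (pdmx c T x)^T.
Proof. by apply/matrixP => a b; rewrite !mxE; under eq_fun do rewrite mxE. Qed.

Lemma pdmxD m n c (S T : 'rV[R]_4 -> 'M[R]_(m, n)) x :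
  smooth_mx U S -> smooth_mx U T -> U x ->
  pdmx c (fun y => S y + T y) x = pdmx c S x + pdmx c T x.
Proof.
move=> sS sT Ux; apply/matrixP => a b; rewrite !mxE.
by under eq_fun do rewrite mxE; rewrite pdD//; exact: smooth_mx_diff.
Qed.

Lemma pdmxN m n c (T : 'rV[R]_4 -> 'M[R]_(m, n)) x :
  smooth_mx U T -> U x -> pdmx c (fun y => - T y) x = - pdmx c T x.
Proof.
move=> sT Ux; apply/matrixP => a b; rewrite !mxE.
by under eq_fun do rewrite mxE; rewrite pdN//; exact: smooth_mx_diff.
Qed.

Lemma pdmxB m n c (S T : 'rV[R]_4 -> 'M[R]_(m, n)) x :
  smooth_mx U S -> smooth_mx U T -> U x ->
  pdmx c (fun y => S y - T y) x = pdmx c S x - pdmx c T x.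
Proof. by move=> sS sT Ux; rewrite pdmxD ?pdmxN//; exact: smooth_mxN. Qed.

Lemma pdmxZ m n c (k : 'rV[R]_4 -> R) (T : 'rV[R]_4 -> 'M[R]_(m, n)) x :
  smooth_on U k -> smooth_mx U T -> U x ->
  pdmx c (fun y => k y *: T y) x = pd c k x *: T x + k x *: pdmx c T x.
Proof.
move=> sk sT Ux; apply/matrixP => a b; rewrite !mxE.
under eq_fun do rewrite mxE; rewrite pdM//; last exact: smooth_mx_diff.
exact: smooth_on_diff sk Ux.
Qed.

Lemma pdmxM m n p c (S : 'rV[R]_4 -> 'M[R]_(m, n))
    (T : 'rV[R]_4 -> 'M[R]_(n, p)) x :
  smooth_mx U S -> smooth_mx U T -> U x ->
  pdmx c (fun y => S y *m T y) x = pdmx c S x *m T x + S x *m pdmx c T x.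
Proof.
move=> sS sT Ux; apply/matrixP => a b; rewrite !mxE.
have dS e := smooth_mx_diff a e sS Ux; have dT e := smooth_mx_diff e b sT Ux.
under eq_fun do rewrite mxE.
rewrite pd_sum; last by move=> e; exact: differentiableM (dS e) (dT e).
by rewrite -big_split; apply: eq_bigr => e _; rewrite !mxE pdM.
Qed.

Lemma pdmx_comm m n c d (T : 'rV[R]_4 -> 'M[R]_(m, n)) x :
  smooth_mx U T -> U x -> pdmx c (pdmx d T) x = pdmx d (pdmx c T) x.
Proof.
move=> sT Ux; have E e i j : (fun y => pdmx e T y i j) = pd e (fun y => T y i j).
  by apply/funext => y; rewrite mxE.
apply/matrixP => a b.
have H := pd_comm c d openU (sT a b) Ux.
rewrite [LHS]pdmxE [RHS]pdmxE.
apply: (etrans (congr1 (fun F => pd c F x) (E d a b))); apply: (etrans H).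
exact: (congr1 (fun F => pd d F x) (esym (E c a b))).
Qed.

Section Covariant.
Variables (m n : nat) (A : 'I_4 -> 'rV[R]_4 -> 'M[R]_m)
  (A' : 'I_4 -> 'rV[R]_4 -> 'M[R]_n).
Hypotheses (sA : forall c, smooth_mx U (A c)) (sA' : forall c, smooth_mx U (A' c)).

(** Independent connection matrices on the two sides cover both uses: [A'] is the transpose of [A]
    for bilinear forms, and [- A] for endomorphisms such as [J]. *)
Definition covmx c (T : 'rV[R]_4 -> 'M[R]_(m, n)) x : 'M[R]_(m, n) :=
  pdmx c T x - A c x *m T x - T x *m A' c x.

Lemma smooth_covmx c T : smooth_mx U T -> smooth_mx U (covmx c T).
Proof.
move=> sT; apply: smooth_mxB; last exact: smooth_mxM.
by apply: smooth_mxB; [exact: smooth_pdmx|exact: smooth_mxM].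
Qed.

(** Second partial derivatives cancel by symmetry and the first-order terms cancel in pairs, so the
    curvatures of the two sides remain, acting algebraically on [T]. *)
Lemma covmx_commutator c d T x : smooth_mx U T -> U x ->
  covmx c (covmx d T) x - covmx d (covmx c T) x =
  - ((pdmx c (A d) x - pdmx d (A c) x + A d x *m A c x - A c x *m A d x) *m T x
   + T x *m (pdmx c (A' d) x - pdmx d (A' c) x + A' c x *m A' d x - A' d x *m A' c x)).
Proof.
move=> sT Ux; have sp e : smooth_mx U (pdmx e T) by exact: smooth_pdmx.
have sa e : smooth_mx U (fun y => A e y *m T y) by exact: smooth_mxM.
have sb e : smooth_mx U (fun y => T y *m A' e y) by exact: smooth_mxM.
have sab e : smooth_mx U (fun y => pdmx e T y - A e y *m T y).
  exact: smooth_mxB.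
have dcov e h : pdmx e (covmx h T) x = pdmx e (pdmx h T) x
    - (pdmx e (A h) x *m T x + A h x *m pdmx e T x)
    - (pdmx e T x *m A' h x + T x *m pdmx e (A' h) x).
  rewrite (pdmxB _ (sab h) (sb h) Ux) (pdmxB _ (sp h) (sa h) Ux).
  by rewrite (pdmxM _ (sA h) sT Ux) (pdmxM _ sT (sA' h) Ux).
have covE e S : covmx e S x = pdmx e S x - A e x *m S x - S x *m A' e x by [].
rewrite !covE !dcov (pdmx_comm c d sT Ux).
move: (pdmx d (pdmx c T) x) (pdmx c T x) (pdmx d T x) (pdmx c (A d) x)
  (pdmx d (A c) x) (pdmx c (A' d) x) (pdmx d (A' c) x)
  (A c x) (A d x) (A' c x) (A' d x) (T x) => *; mxlinear.
Qed.

End Covariant.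

Section Connection.
Variable G : coefficients R.

Definition connmx c x : 'M[R]_4 := \matrix_(b, a) G a b c x.

Definition curvmx c d x : 'M[R]_4 := \matrix_(b, a) curvature G a b c d x.

(** Matrices act on row vectors from the right, which reverses the quadratic terms of
    [curvature]. *)
Lemma curvmxE c d x : curvmx c d x =
  pdmx c (connmx d) x - pdmx d (connmx c) x
  + connmx d x *m connmx c x - connmx c x *m connmx d x.
Proof.
apply/matrixP => b a; rewrite !mxE /curvature.
have E e : (fun y => connmx e y b a) = G a b e by apply/funext => y; rewrite mxE.
rewrite !E -addrA -sumrB; congr (_ + _); apply: eq_bigr => e _.
by rewrite ?mxE mulrC [G a e d x * _]mulrC.
Qed.

Hypothesis sG : forall a b c, smooth_on U (G a b c).

Lemma smooth_connmx c : smooth_mx U (connmx c).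
Proof. by move=> b a; under eq_fun do rewrite mxE; exact: sG. Qed.

Lemma smooth_curvature a b c d : smooth_on U (curvature G a b c d).
Proof.
apply: smooth_onD => //.
  by apply: smooth_onB => //; exact: smooth_on_pd.
by apply: smooth_on_sum => // e; apply: smooth_onB => //; exact: smooth_onM.
Qed.

(** The terms in the index that records the direction of differentiation are
    absent from [covmx]; they are added separately where they matter. *)
Definition cov2 c (T : 'rV[R]_4 -> 'M[R]_4) : 'rV[R]_4 -> 'M[R]_4 :=
  covmx connmx (fun c y => (connmx c y)^T) c T.

Lemma nabla2E (T : 'I_4 -> 'I_4 -> 'rV[R]_4 -> R) c a b x :
  nabla2 G T c a b x = cov2 c (fun y => \matrix_(a, b) T a b y) x a b.
Proof.
rewrite /nabla2 !mxE; congr (_ - _ - _).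
- by under [in RHS]eq_fun do rewrite mxE.
- by apply: eq_bigr => e _; rewrite !mxE.
- by apply: eq_bigr => e _; rewrite !mxE mulrC.
Qed.

Lemma cov2_commutator c d (T : 'rV[R]_4 -> 'M[R]_4) x : smooth_mx U T -> U x ->
  cov2 c (cov2 d T) x - cov2 d (cov2 c T) x =
  - (curvmx c d x *m T x + T x *m (curvmx c d x)^T).
Proof.
move=> sT Ux; have sC := smooth_connmx.
rewrite covmx_commutator//; last by move=> e; exact: smooth_mx_tr.
rewrite -curvmxE curvmxE; congr (- (_ + _ *m _)).
by rewrite !linearD /= !linearN /= !trmx_mul !pdmx_tr.
Qed.

End Connection.

End MatrixDerivatives.

(** * Weyl and Levi-Civita connections *)

Section WeylConnection.
Variables (R : realType) (U : set 'rV[R]_4) (openU : open U).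
Variables (g : 'rV[R]_4 -> 'M[R]_4) (B : 'rV[R]_4 -> 'rV[R]_4)
  (G : coefficients R).
Hypotheses (sg : smooth_mx U g) (sB : smooth_mx U B)
  (sG : forall a b c, smooth_on U (G a b c)).
Hypotheses (g_sym : forall x, U x -> (g x)^T = g x)
  (g_unit : forall x, U x -> g x \in unitmx)
  (G_sym : forall x, U x -> forall a b c, G a b c x = G a c b x)
  (G_weyl : forall x, U x -> forall c, cov2 G c g x = - B x 0 c *: g x).

Local Notation e c := (delta_mx 0 c : 'rV[R]_4).
Local Notation Gam := (connmx G).

(** The vector field dual to [B]. It is known only through its equation, so its derivative follows
    from the product rule, without differentiating an inverse matrix. *)
Variable beta : 'rV[R]_4 -> 'rV[R]_4.
Hypotheses (sbeta : smooth_mx U beta)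
  (betaK : forall x, U x -> beta x *m g x = B x).

(** Twice the difference between the Weyl and the Levi-Civita connection. *)
Definition weyl_shift c x : 'M[R]_4 :=
  B x 0 c *: 1%:M + (B x)^T *m e c - g x *m (e c)^T *m beta x.

Lemma weyl_shift_metric c x : U x -> weyl_shift c x *m g x =
  B x 0 c *: g x + (B x)^T *m e c *m g x - g x *m (e c)^T *m B x.
Proof.
move=> Ux; rewrite mulmxBl mulmxDl -scalemxAl mul1mx.
by rewrite -[_ *m beta x *m _]mulmxA betaK.
Qed.

Lemma pd_metric c x : U x ->
  pdmx c g x = Gam c x *m g x + g x *m (Gam c x)^T - B x 0 c *: g x.
Proof.
move=> Ux; rewrite -scaleNr -(G_weyl Ux) /cov2 /covmx.
by rewrite addrACA [X in X + _]addrCA; mxlinear.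
Qed.

Lemma conn_row_sym c d x : U x -> e d *m Gam c x = e c *m Gam d x.
Proof.
by move=> Ux; apply/rowP => a; rewrite -!rowE !mxE (G_sym Ux).
Qed.

(** Once [pd_metric] replaces the derivatives of [g] in the Christoffel formula, symmetry in the
    lower indices leaves the Weyl coefficients twice, and the terms in [B] assemble into
    [weyl_shift]. *)
Lemma levi_civita_weyl c x : U x ->
  connmx (levi_civita g) c x = Gam c x - 2^-1 *: weyl_shift c x.
Proof.
move=> Ux.
have E : connmx (levi_civita g) c x =
    2^-1 *: ((2 *: Gam c x - weyl_shift c x) *m g x *m invmx (g x)).
  rewrite mulmxBl weyl_shift_metric// -scalemxAl.
  apply/matrixP => b a; rewrite !mxE /levi_civita; congr (_ * _).
  apply: eq_bigr => d _; rewrite [RHS]mulrC; congr (_ * _).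
    by rewrite -[in LHS](g_sym Ux) -trmx_inv mxE.
  have pdE e' i j : pd e' (fun y => g y i j) x =
      (Gam e' x *m g x) i j + (Gam e' x *m g x) j i - B x 0 e' * g x i j.
    rewrite -pdmxE pd_metric// !linmxE; congr (_ + _ - _).
    by rewrite -[in LHS](g_sym Ux) -trmx_mul mxE.
  have Lsym i j k : (Gam i x *m g x) j k = (Gam j x *m g x) i k.
    have := conn_row_sym i j Ux; move/(congr1 (fun r => (r *m g x) 0 k)).
    by rewrite -!mulmxA -!rowE !mxE.
  have gs i j : g x i j = g x j i by rewrite -[in LHS](g_sym Ux) mxE.
  have S1 : ((B x)^T *m e c *m g x) b d = B x 0 b * g x c d.
    by rewrite -mulmxA -rowE mxE big_ord1 !mxE.
  have S2 : (g x *m (e c)^T *m B x) b d = g x b c * B x 0 d.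
    by rewrite trmx_delta -colE mxE big_ord1 !mxE.
  rewrite !pdE !linmxE S1 S2 (Lsym b c d) (Lsym b d c) (Lsym c d b).
  rewrite (gs d c) (gs d b); ring.
by rewrite E mulmxK ?g_unit// scalerBr scalerA mulVf ?scale1r ?pnatr_eq0.
Qed.

Definition dform c d x : R :=
  pd c (fun y => B y 0 d) x - pd d (fun y => B y 0 c) x.

(** The commutator of covariant derivatives is applied to [g] itself. Since nabla g = - B g, the
    products of components of [B] are symmetric in the two directions and only [dform] survives. *)
Lemma curvmx_metric c d x : U x ->
  curvmx G c d x *m g x + g x *m (curvmx G c d x)^T = dform c d x *: g x.
Proof.
move=> Ux; have sBd e' : smooth_on U (fun y => - B y 0 e').
  by apply: smooth_onN => //; exact: (sB 0 e').
have H e' h : cov2 G e' (cov2 G h g) x =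
    - pd e' (fun y => B y 0 h) x *: g x + (B x 0 h * B x 0 e') *: g x.
  have covE : cov2 G e' (cov2 G h g) x = pdmx e' (cov2 G h g) x
      - Gam e' x *m cov2 G h g x - cov2 G h g x *m (Gam e' x)^T by [].
  rewrite covE (pdmx_congr openU e' (fun y Uy => G_weyl Uy h) Ux).
  rewrite (pdmxZ _ (sBd h) sg Ux) pd_metric// G_weyl// pdN; last first.
    exact: smooth_mx_diff sB Ux.
  by mxlinear.
have := cov2_commutator openU sG c d sg Ux.
by rewrite !H => /(congr1 -%R); rewrite opprK => <-; rewrite /dform; mxlinear.
Qed.

Lemma smooth_weyl_shift c : smooth_mx U (weyl_shift c).
Proof.
have se : smooth_mx U (fun=> e c) by exact: smooth_mx_cst.
have sI : smooth_mx U (fun=> 1%:M : 'M[R]_4) by exact: smooth_mx_cst.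
have s1 := smooth_mxZ openU (sB 0 c) sI.
have s2 := smooth_mxM openU (smooth_mx_tr sB) se.
have s3 := smooth_mxM openU (smooth_mxM openU sg (smooth_mx_tr se)) sbeta.

exact (smooth_mxB openU (smooth_mxD openU s1 s2) s3).
Qed.

(** Substitution of [levi_civita_weyl] into the curvature. [dS] differentiates the shift with the
    Weyl connection but omits the Christoffel term of the direction index, which is symmetric and
    would drop out of the difference. *)
Lemma curvmx_levi_civita c d x : U x ->
  let S c := weyl_shift c x in
  let dS c d := pdmx c (weyl_shift d) x - Gam c x *m S d + S d *m Gam c x in
  curvmx G c d x = curvmx (levi_civita g) c d x
    + 2^-1 *: (dS c d - dS d c) + 2^-1 *: (2^-1 *: (S c *m S d - S d *m S c)).
Proof.
move=> Ux S dS.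
have H e' h : pdmx e' (connmx (levi_civita g) h) x =
    pdmx e' (Gam h) x - 2^-1 *: pdmx e' (weyl_shift h) x.
  rewrite (pdmx_congr openU e' (fun y Uy => levi_civita_weyl h Uy) Ux).
  have sS := smooth_weyl_shift h.
  have sk : smooth_on U (fun=> 2^-1 : R) by exact: smooth_on_cst.
  rewrite (pdmxB openU _ (smooth_connmx sG h) (smooth_mxZ openU sk sS) Ux).
  by rewrite (pdmxZ _ sk sS Ux) pd_cst scale0r add0r.
rewrite !curvmxE !H !levi_civita_weyl// /dS /S.
move: (pdmx c (Gam d) x) (pdmx d (Gam c) x) (Gam c x) (Gam d x)
  (pdmx c (weyl_shift d) x) (pdmx d (weyl_shift c) x)
  (weyl_shift c x) (weyl_shift d x) => *; mxlinear.
Qed.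

(** The Weyl covariant derivative of [B] in direction [c]. *)
Let conn_form c x : 'rV[R]_4 := pdmx c B x - B x *m (Gam c x)^T.

(** The lowered Christoffel row of the direction index [d]. By absence of torsion it is symmetric in
    [c] and [d], so it cancels in [curvature_shift]. *)
Let conn_row (c d : 'I_4) x : 'rV[R]_4 := e d *m Gam c x *m g x.

Lemma pd_beta c x : U x ->
  pdmx c beta x *m g x = pdmx c B x - beta x *m pdmx c g x.
Proof.
move=> Ux; apply/eqP; rewrite eq_sym subr_eq -(pdmxM c sbeta sg Ux).
by apply/eqP; exact: (pdmx_congr openU c (fun y Uy => esym (betaK Uy)) Ux).
Qed.

(** For fixed [B], [weyl_shift] does not change when [g] is rescaled, because [beta] contains the
    inverse of [g]. Hence the terms in [B x 0 c] that arise from differentiating [g] cancel. *)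
Lemma cov_weyl_shift c d x : U x ->
  (pdmx c (weyl_shift d) x - Gam c x *m weyl_shift d x
    + weyl_shift d x *m Gam c x) *m g x =
  pd c (fun y => B y 0 d) x *: g x
  + (conn_form c x)^T *m e d *m g x - g x *m (e d)^T *m conn_form c x
  + ((B x)^T *m conn_row c d x - (conn_row c d x)^T *m B x).
Proof.
move=> Ux.
have se : smooth_mx U (fun=> e d) by exact: smooth_mx_cst.
have sI : smooth_mx U (fun=> 1%:M : 'M[R]_4) by exact: smooth_mx_cst.
have s1 := smooth_mxZ openU (sB 0 d) sI.
have s2 := smooth_mxM openU (smooth_mx_tr sB) se.
have s4 := smooth_mxM openU sg (smooth_mx_tr se).
have s3 := smooth_mxM openU s4 sbeta.
have pS : pdmx c (weyl_shift d) x = pd c (fun y => B y 0 d) x *: 1%:M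
    + (pdmx c B x)^T *m e d
    - (pdmx c g x *m (e d)^T *m beta x + g x *m (e d)^T *m pdmx c beta x).
  rewrite (pdmxB openU c (smooth_mxD openU s1 s2) s3 Ux) (pdmxD c s1 s2 Ux).
  rewrite (pdmxZ c (sB 0 d) sI Ux) (pdmxM c (smooth_mx_tr sB) se Ux).
  rewrite (pdmxM c s4 sbeta Ux) (pdmxM c sg (smooth_mx_tr se) Ux).
  by rewrite pdmx_tr !pdmx_cst !mulmx0 scaler0 !addr0.
rewrite mulmxDl mulmxBl -[_ *m weyl_shift d x *m _]mulmxA weyl_shift_metric//.
have -> : weyl_shift d x *m Gam c x *m g x = B x 0 d *: (Gam c x *m g x)
    + (B x)^T *m conn_row c d x - g x *m (e d)^T *m (beta x *m Gam c x *m g x).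
  by rewrite /weyl_shift /conn_row; mxlinear.
have -> : pdmx c (weyl_shift d) x *m g x = pd c (fun y => B y 0 d) x *: g x
    + (pdmx c B x)^T *m e d *m g x
    - (pdmx c g x *m (e d)^T *m B x
       + g x *m (e d)^T *m (pdmx c B x - beta x *m pdmx c g x)).
  rewrite pS mulmxBl !mulmxDl -scalemxAl mul1mx.
  by rewrite -!(mulmxA _ _ (g x)) pd_beta// betaK// !mulmxA.
have -> : beta x *m pdmx c g x = beta x *m Gam c x *m g x
    + B x *m (Gam c x)^T - B x 0 c *: B x.
  by rewrite pd_metric// mulmxBr mulmxDr -scalemxAr betaK// !mulmxA betaK.
have -> : (conn_row c d x)^T = g x *m (Gam c x)^T *m (e d)^T.
  by rewrite !trmx_mul g_sym// mulmxA.
have -> : (conn_form c x)^T = (pdmx c B x)^T - Gam c x *m (B x)^T.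
  by rewrite linearB /= trmx_mul trmxK.
rewrite pd_metric// /conn_form.
move: (beta x *m Gam c x *m g x) (pdmx c B x) (conn_row c d x)
  ((pdmx c B x)^T) ((B x)^T) => *; mxlinear.
Qed.

Lemma mul_weyl_shift c d x : U x ->
  weyl_shift c x *m weyl_shift d x *m g x =
  (B x 0 c * B x 0 d) *: g x + (2 * B x 0 c) *: ((B x)^T *m e d *m g x)
  - B x 0 c *: (g x *m (e d)^T *m B x) + B x 0 d *: ((B x)^T *m e c *m g x)
  - g x c d *: ((B x)^T *m B x)
  - (beta x *m (B x)^T) 0 0 *: (g x *m (e c)^T *m (e d *m g x)).
Proof.
move=> Ux; rewrite -mulmxA weyl_shift_metric//.
have eB : e c *m (B x)^T = (B x 0 c)%:M.
  by rewrite [LHS]mx11_scalar -rowE !mxE.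
have eg : e c *m g x *m (e d)^T = (g x c d)%:M.
  by rewrite [LHS]mx11_scalar trmx_delta -colE -rowE !mxE.
have bg : B x *m (e d)^T = (B x 0 d)%:M.
  by rewrite [LHS]mx11_scalar trmx_delta -colE !mxE.
have bB := mx11_scalar (beta x *m (B x)^T).
rewrite {1}/weyl_shift !(mulmxDl, mulmxBl, mulmxDr, mulmxBr, mulmxN, mulNmx).
have -> : (B x)^T *m e c *m ((B x)^T *m e d *m g x) =
    B x 0 c *: ((B x)^T *m e d *m g x).
  rewrite !mulmxA -(mulmxA _ (e c)) eB mul_mx_scalar -!scalemxAl; done.
have -> : (B x)^T *m e c *m (g x *m (e d)^T *m B x) =
    g x c d *: ((B x)^T *m B x).
  transitivity ((B x)^T *m (e c *m g x *m (e d)^T) *m B x).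
    by rewrite !mulmxA.
  by rewrite eg mul_mx_scalar -scalemxAl.
have -> : g x *m (e c)^T *m beta x *m (g x *m (e d)^T *m B x) =
    B x 0 d *: (g x *m (e c)^T *m B x).
  rewrite -(mulmxA _ (beta x)) !(mulmxA (beta x)) betaK// bg mul_scalar_mx.
  by rewrite -scalemxAr.
have -> : g x *m (e c)^T *m beta x *m ((B x)^T *m e d *m g x) =
    (beta x *m (B x)^T) 0 0 *: (g x *m (e c)^T *m (e d *m g x)).
  transitivity (g x *m (e c)^T *m (beta x *m (B x)^T) *m (e d *m g x)).
    by rewrite !mulmxA.
  by rewrite {1}bB mul_mx_scalar -scalemxAl.
rewrite -!(mulmxA _ (beta x)) -!scalemxAr betaK//.
mxlinear.
Qed.


(** The Kulkarni-Nomizu product of [h] and [Q]. *)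
Definition kn (h Q : 'M[R]_4) a b c d : R :=
  h a c * Q b d - h a d * Q b c + h b d * Q a c - h b c * Q a d.

(** [Q] is the familiar change of the Schouten tensor; the term in [dform] is there because the Weyl
    curvature is not skew with respect to [g]. Existence of [Q] suffices, as a trace identifies it
    later. *)
Lemma curvature_shift x : U x -> exists Q : 'M[R]_4, forall a b c d,
  (curvmx G c d x *m g x) b a = (curvmx (levi_civita g) c d x *m g x) b a
    + 2^-1 * dform c d x * g x a b + kn (g x) Q a b c d.
Proof.
move=> Ux; pose n := (beta x *m (B x)^T) 0 0.
(* Classically - nabla B / 2 - B B / 4 + |B|^2 g / 8, with [n] the squared length of [B]. The
   fractions stem from the factor [2^-1] in [levi_civita_weyl]. *)
pose q b d : R := - (2^-1 * conn_form d x 0 b) - 4^-1 * (B x 0 b * B x 0 d)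
  + 8^-1 * n * g x b d.
exists (\matrix_(b, d) q b d) => a b c d.
have qE i j : (\matrix_(b, d) q b d) i j = q i j by rewrite mxE.
have gs i j : g x i j = g x j i by rewrite -[in LHS](g_sym Ux) mxE.
have rowE (r : 'rV[R]_4) h : (r^T *m e h *m g x) b a = r 0 b * g x h a.
  by rewrite -mulmxA -rowE mxE big_ord1 !mxE.
have colE (r : 'rV[R]_4) h : (g x *m (e h)^T *m r) b a = g x b h * r 0 a.
  by rewrite trmx_delta -colE mxE big_ord1 !mxE.
have E1 h k : (g x *m (e h)^T *m (e k *m g x)) b a = g x b h * g x k a.
  by rewrite colE -matrix.rowE mxE.
have E2 (r s : 'rV[R]_4) : (r^T *m s) b a = r 0 b * s 0 a.
  by rewrite mxE big_ord1 mxE.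
have dist (A X Y P P' : 'M[R]_4) :
    (A + 2^-1 *: (X - Y) + 2^-1 *: (2^-1 *: (P - P'))) *m g x =
    A *m g x + 2^-1 *: (X *m g x - Y *m g x)
    + 2^-1 *: (2^-1 *: (P *m g x - P' *m g x)) by mxlinear.
rewrite (curvmx_levi_civita c d Ux) dist.
rewrite !cov_weyl_shift// !mul_weyl_shift//.
have -> : conn_row d c x = conn_row c d x.
  by rewrite /conn_row (conn_row_sym c d Ux).
rewrite -/n !linmxE !E1 !rowE !colE !E2 /kn !qE /q /dform.
rewrite (gs d c) (gs b a) (gs c a) (gs d a).
by field.
Qed.

End WeylConnection.

(** * Contractions with the inverse metric *)

Section Traces.
Variable R : realType.
Variables (h : 'M[R]_4).
Hypotheses (h_sym : h^T = h) (h_unit : h \in unitmx).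

Local Notation hi := (invmx h).

Lemma trace_lower (A : 'I_4 -> 'M[R]_4) b :
  \sum_c \sum_a (A c *m h) b a * hi a c = \sum_c A c b c.
Proof.
apply: eq_bigr => c _; rewrite -[in RHS](mulmxK h_unit (A c)) mxE.
by apply: eq_bigr => a _; rewrite mulrC mulrC.
Qed.

Let sum_delta (F : 'I_4 -> R) d : \sum_c F c * (c == d)%:R = F d.
Proof.
rewrite (bigD1 d)//= eqxx mulr1 big1 ?addr0// => c /negbTE ->.
by rewrite mulr0.
Qed.

Let hs i j : h i j = h j i.
Proof. by rewrite -[in LHS]h_sym mxE. Qed.

Let h_hi c d : \sum_a h a c * hi a d = (d == c)%:R.
Proof.
have := congr1 (fun A : 'M[R]_4 => A c d) (mulmxV h_unit).
rewrite !mxE eq_sym => <-; apply: eq_bigr => a _.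
by rewrite hs.
Qed.

Let hi_h a b : \sum_c h b c * hi a c = (a == b)%:R.
Proof.
have := congr1 (fun A : 'M[R]_4 => A a b) (mulVmx h_unit).
rewrite !mxE => <-; apply: eq_bigr => c _.
by rewrite hs mulrC.
Qed.

Lemma trace_metric b d (f : 'I_4 -> 'I_4 -> R) :
  \sum_c \sum_a f c d * h a b * hi a c = f b d.
Proof.
rewrite -[RHS](sum_delta (f^~ d)); apply: eq_bigr => c _.
by under eq_bigr do rewrite -mulrA; rewrite -mulr_sumr h_hi.
Qed.

(** The coefficient 2 is 4 - 1 - 1: the trace of the metric in dimension 4, less the two mixed
    terms. *)
Lemma kn_trace (Q : 'M[R]_4) b d :
  \sum_c \sum_a kn h Q a b c d * hi a c =
  2 * Q b d + (\sum_c \sum_a Q a c * hi a c) * h b d.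
Proof.
have -> : \sum_c \sum_a kn h Q a b c d * hi a c =
    (\sum_c Q b d * \sum_a h a c * hi a c) - (\sum_c Q b c * \sum_a h a d * hi a c)
    + h b d * (\sum_c \sum_a Q a c * hi a c)
    - \sum_a Q a d * (\sum_c h b c * hi a c).
  have -> : \sum_a Q a d * (\sum_c h b c * hi a c) =
      \sum_c \sum_a Q a d * (h b c * hi a c).
    by rewrite exchange_big; apply: eq_bigr => a _; rewrite mulr_sumr.
  rewrite mulr_sumr -sumrB -big_split -sumrB; apply: eq_bigr => c _ /=.
  rewrite !mulr_sumr -sumrB -big_split -sumrB; apply: eq_bigr => a _ /=.
  by rewrite /kn; ring.
under eq_bigr do rewrite h_hi eqxx mulr1.
have -> : \sum_c Q b c * (\sum_a h a d * hi a c) = Q b d.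
  by rewrite -[RHS](sum_delta (Q b)); apply: eq_bigr => c _; rewrite h_hi.
have -> : \sum_a Q a d * (\sum_c h b c * hi a c) = Q b d.
  by rewrite -[RHS](sum_delta (Q^~ d)); apply: eq_bigr => a _; rewrite hi_h.
rewrite sumr_const card_ord -mulr_natr; ring.
Qed.

End Traces.

(** * The Weyl tensor in terms of the curvature of the Weyl connection *)

Section WeylDecomposition.
Variables (R : realType) (U : set 'rV[R]_4) (openU : open U).
Variables (g : 'rV[R]_4 -> 'M[R]_4) (B : 'rV[R]_4 -> 'rV[R]_4)
  (G : coefficients R).
Hypotheses (sg : smooth_mx U g) (sB : smooth_mx U B)
  (sG : forall a b c, smooth_on U (G a b c)).
Hypotheses (g_sym : forall x, U x -> (g x)^T = g x)
  (g_unit : forall x, U x -> g x \in unitmx)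
  (G_sym : forall x, U x -> forall a b c, G a b c x = G a c b x)
  (G_weyl : forall x, U x -> forall c, cov2 G c g x = - B x 0 c *: g x).

Lemma ricciE (H : coefficients R) b d x :
  ricci H b d x = \sum_c curvmx H c d x b c.
Proof. by apply: eq_bigr => c _; rewrite mxE. Qed.

Lemma weylE a b c d x : U x -> weyl g a b c d x =
  (curvmx (levi_civita g) c d x *m g x) b a
  - kn (g x) (\matrix_(i, j) schouten g (levi_civita g) i j x) a b c d.
Proof.
move=> Ux; rewrite /weyl /kn !mxE; congr (_ - _); apply: eq_bigr => e _.
by rewrite !mxE mulrC -[in LHS](g_sym Ux) mxE.
Qed.

(** The factor is 1/2 - 4/12, the 4 being the trace of the metric. *)
Lemma schouten_trace H x : U x ->
  \sum_c \sum_a schouten g H a c x * invmx (g x) a c =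
  6^-1 * scalar_curvature g H x.
Proof.
move=> Ux; have giE a c : invmx (g x) a c = invmx (g x) c a.
  by rewrite -[in LHS](g_sym Ux) -trmx_inv mxE.
have tr4 : \sum_c \sum_a g x a c * invmx (g x) a c = 4.
  have := congr1 (fun A => \tr A) (mulVmx (g_unit Ux)); rewrite mxtrace1 => <-.
  apply: eq_bigr => c _; rewrite mxE; apply: eq_bigr => a _.
  by rewrite giE mulrC.
have -> : \sum_c \sum_a schouten g H a c x * invmx (g x) a c =
    2^-1 * scalar_curvature g H x - 12^-1 * scalar_curvature g H x *
      \sum_c \sum_a g x a c * invmx (g x) a c.
  have sE : scalar_curvature g H x =
      \sum_c \sum_a invmx (g x) a c * ricci H a c x by exact: exchange_big.
  rewrite [in X in 2^-1 * X]sE /schouten; move: (scalar_curvature g H x) => s.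
  rewrite !mulr_sumr -sumrB; apply: eq_bigr => c _.
  by rewrite !mulr_sumr -sumrB; apply: eq_bigr => a _; ring.
by rewrite tr4; field.
Qed.

(** The Schouten tensor is normalised for this: by [kn_trace] and [schouten_trace], its
    Kulkarni-Nomizu product with [g] contracts to the Ricci tensor. *)
Lemma weyl_trace b d x : U x ->
  \sum_c \sum_a weyl g a b c d x * invmx (g x) a c = 0.
Proof.
move=> Ux; under eq_bigr do under eq_bigr do rewrite weylE// mulrBl.
under eq_bigr do rewrite sumrB.
rewrite sumrB trace_lower ?g_unit// -ricciE kn_trace ?g_sym ?g_unit//.
have -> : \sum_c \sum_a (\matrix_(i, j) schouten g (levi_civita g) i j x) a c
    * invmx (g x) a c = 6^-1 * scalar_curvature g (levi_civita g) x.
  rewrite -schouten_trace//.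
  by apply: eq_bigr => c _; apply: eq_bigr => a _; rewrite mxE.
by rewrite mxE /schouten; field.
Qed.

(** [Q] is the tensor from [curvature_shift] plus the Levi-Civita Schouten tensor. Its explicit form
    is never unfolded: contracting the first formula and using [weyl_trace] gives the second, with
    [t] the trace of [Q]. *)
Lemma weyl_decomposition x : U x -> exists (t : R) (Q : 'M[R]_4),
  (forall a b c d, weyl g a b c d x = (curvmx G c d x *m g x) b a
     - 2^-1 * dform B c d x * g x a b - kn (g x) Q a b c d) /\
  (forall b d, 2 * Q b d =
     ricci G b d x - 2^-1 * dform B b d x - t * g x b d).
Proof.
move=> Ux; pose beta y := B y *m invmx (g y).
have sbeta : smooth_mx U beta.
  by apply: smooth_mxM => //; exact: smooth_invmx.
have betaK y : U y -> beta y *m g y = B y.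
  by move=> Uy; rewrite mulmxKV// g_unit.
have [Q' shift] := curvature_shift openU sg sB sG g_sym g_unit G_sym G_weyl
  sbeta betaK Ux.
pose Q := Q' + \matrix_(i, j) schouten g (levi_civita g) i j x.
exists (\sum_c \sum_a Q a c * invmx (g x) a c), Q.
have W a b c d : weyl g a b c d x = (curvmx G c d x *m g x) b a
     - 2^-1 * dform B c d x * g x a b - kn (g x) Q a b c d.
  by rewrite weylE// shift /kn /Q !linmxE; ring.
split=> // b d; have := weyl_trace b d Ux.
have mulrBBl (u v w z : R) : (u - v - w) * z = u * z - v * z - w * z by ring.
under eq_bigr do under eq_bigr do rewrite W mulrBBl.
under eq_bigr do rewrite !sumrB.
rewrite !sumrB trace_lower ?g_unit// -ricciE kn_trace ?g_sym ?g_unit//.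
rewrite (trace_metric (g_sym Ux) (g_unit Ux) b d (fun c d => 2^-1 * dform B c d x)).
by move=> /eqP; rewrite subr_eq0 => /eqP ->; ring.
Qed.

End WeylDecomposition.

(** * Bilinear forms and tensors with values in endomorphisms *)

Section BilinearForms.
Variables (F : fieldType).
Implicit Types (A G : 'M[F]_4) (X Y Z W : 'rV[F]_4)
  (T : 'I_4 -> 'I_4 -> 'M[F]_4).

Definition bil G X Y : F := (X *m G *m Y^T) 0 0.

Lemma bilDl G X Y Z : bil G (X + Y) Z = bil G X Z + bil G Y Z.
Proof. by rewrite /bil !mulmxDl mxE. Qed.

Lemma bilDr G X Y Z : bil G X (Y + Z) = bil G X Y + bil G X Z.
Proof. by rewrite /bil linearD /= mulmxDr mxE. Qed.

Lemma bilNl G X Y : bil G (- X) Y = - bil G X Y.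
Proof. by rewrite /bil !mulNmx mxE. Qed.

Lemma bilZl G k X Y : bil G (k *: X) Y = k * bil G X Y.
Proof. by rewrite /bil -!scalemxAl mxE. Qed.

Lemma bilZr G k X Y : bil G X (k *: Y) = k * bil G X Y.
Proof. by rewrite /bil linearZ /= -scalemxAr mxE. Qed.

Lemma bil0l G X : bil G 0 X = 0.
Proof. by rewrite /bil !mul0mx mxE. Qed.

Lemma bilC G X Y : G^T = G -> bil G X Y = bil G Y X.
Proof.
move=> sG; rewrite /bil -[in LHS](trmxK (X *m G *m Y^T)) mxE.
by rewrite !trmx_mul trmxK sG mulmxA.
Qed.

Lemma bil_addmx G A X Y : bil (G + A) X Y = bil G X Y + bil A X Y.
Proof. by rewrite /bil mulmxDr mulmxDl mxE. Qed.

Lemma bil_oppmx G X Y : bil (- G) X Y = - bil G X Y.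
Proof. by rewrite /bil mulmxN mulNmx mxE. Qed.

Lemma bil_scalemx k G X Y : bil (k *: G) X Y = k * bil G X Y.
Proof. by rewrite /bil -scalemxAr -scalemxAl mxE. Qed.

Lemma bil_trmx G X Y : bil G^T X Y = bil G Y X.
Proof.
rewrite /bil -[in LHS](trmxK (X *m G^T *m Y^T)) mxE.
by rewrite !trmx_mul !trmxK mulmxA.
Qed.

Lemma bilE G X Y : bil G X Y = \sum_a \sum_b X 0 a * Y 0 b * G a b.
Proof.
rewrite /bil mxE exchange_big; apply: eq_bigr => b _ /=.
by rewrite !mxE mulr_suml; apply: eq_bigr => a _; rewrite mulrAC.
Qed.

Definition bext (T : 'I_4 -> 'I_4 -> 'M[F]_4) X Y : 'M[F]_4 :=
  \sum_c \sum_d (X 0 c * Y 0 d) *: T c d.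

Lemma bextE T X Y a b :
  bext T X Y a b = \sum_c \sum_d X 0 c * Y 0 d * T c d a b.
Proof.
rewrite summxE; apply: eq_bigr => c _; rewrite summxE.
by apply: eq_bigr => d _; rewrite mxE.
Qed.

Lemma mul_bextE T X Y Z a : (Z *m bext T X Y) 0 a =
  \sum_b \sum_c \sum_d Z 0 b * X 0 c * Y 0 d * T c d b a.
Proof.
rewrite mxE; apply: eq_bigr => b _; rewrite bextE mulr_sumr.
apply: eq_bigr => c _; rewrite mulr_sumr; apply: eq_bigr => d _.
by rewrite !mulrA.
Qed.

Lemma bext_anti T X Y : (forall c d, T c d = - T d c) ->
  bext T X Y = - bext T Y X.
Proof.
move=> aT; rewrite /bext exchange_big -sumrN; apply: eq_bigr => c _ /=.
rewrite -sumrN; apply: eq_bigr => d _.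
by rewrite aT scalerN mulrC.
Qed.

Lemma bext_alt T X : (forall c d, T c d = - T d c) -> (2 : F) != 0 ->
  bext T X X = 0.
Proof.
move=> aT F2; have /eqP := bext_anti X X aT.
rewrite -addr_eq0 -mulr2n -scaler_nat scaler_eq0 (negbTE F2) /=.
by move/eqP.
Qed.

Lemma bext_bianchi T X Y Z :
  (forall a b c d, T c d b a + T d b c a + T b c d a = 0) ->
  Z *m bext T X Y + X *m bext T Y Z + Y *m bext T Z X = 0.
Proof.
move=> bT; apply/rowP => a; rewrite !linmxE !mul_bextE [RHS]mxE.
rewrite [X in _ + X + _](_ : _ =
  \sum_b \sum_c \sum_d Z 0 b * X 0 c * Y 0 d * T d b c a); last first.
  under [RHS]eq_bigr do rewrite exchange_big.
  rewrite [RHS]exchange_big [LHS]exchange_big; apply: eq_bigr => d _.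
  rewrite [RHS]exchange_big; apply: eq_bigr => c _; apply: eq_bigr => b _ /=.
  by rewrite mulrC [RHS]mulrC; congr (_ * _); ring.
rewrite [X in _ + X](_ : _ =
  \sum_b \sum_c \sum_d Z 0 b * X 0 c * Y 0 d * T b c d a); last first.
  rewrite exchange_big; apply: eq_bigr => b _.
  rewrite exchange_big; apply: eq_bigr => c _; apply: eq_bigr => d _ /=.
  by rewrite mulrC [RHS]mulrC; congr (_ * _); ring.
rewrite -!big_split big1// => b _; rewrite -!big_split big1// => c _.
rewrite -!big_split big1// => d _ /=.
by rewrite -!mulrDr bT mulr0.
Qed.

Lemma bext_metric T G f X Y :
  (forall c d, T c d *m G + G *m (T c d)^T = f c d *: G) ->
  bext T X Y *m G + G *m (bext T X Y)^T =
  (\sum_c \sum_d X 0 c * Y 0 d * f c d) *: G.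
Proof.
move=> mT; rewrite /bext mulmx_suml raddf_sum mulmx_sumr -big_split scaler_suml.
apply: eq_bigr => c _ /=.
rewrite mulmx_suml raddf_sum mulmx_sumr -big_split scaler_suml.
apply: eq_bigr => d _ /=.
by rewrite linearZ /= -scalemxAl -scalemxAr -scalerDr mT scalerA.
Qed.

Lemma bext_stable T X Y Z (N : 'M[F]_4) :
  (forall c d, (Z *m T c d <= N)%MS) -> (Z *m bext T X Y <= N)%MS.
Proof.
move=> sT; rewrite mulmx_sumr; apply: summx_sub => c _.
rewrite mulmx_sumr; apply: summx_sub => d _.
by rewrite -scalemxAr scalemx_sub.
Qed.

End BilinearForms.

(** * Null frames *)

Section Frame.
Variables (F : fieldType) (g : 'M[F]_4) (m p n k : 'rV[F]_4).
Implicit Types X Y Z W V : 'rV[F]_4.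
Hypothesis F2 : (2 : F) != 0.
Hypothesis g_sym : g^T = g.
Hypotheses (mp : bil g m p = 1) (nk : bil g n k = 1).
Hypotheses (mm : bil g m m = 0) (pp : bil g p p = 0)
  (nn : bil g n n = 0) (kk : bil g k k = 0).
Hypotheses (mn : bil g m n = 0) (mk : bil g m k = 0)
  (pn : bil g p n = 0) (pk : bil g p k = 0).

Let gC X Y : bil g X Y = bil g Y X. Proof. exact: bilC. Qed.

(** The vectors [p], [m], [k], [n] are the [g]-dual basis of [m], [p], [n], [k]. A one-sided inverse
    of a square matrix is two-sided, so the table of products becomes a resolution of the
    identity. *)
Lemma frame_complete :
  g *m p^T *m m + g *m m^T *m p + g *m k^T *m n + g *m n^T *m k = 1%:M.
Proof.
pose e : 'M[F]_4 := \matrix_(i, j) (tnth [tuple m; p; n; k] i) 0 j.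
pose e' : 'M[F]_4 := \matrix_(i, j) (tnth [tuple p; m; k; n] i) 0 j.
have rowe i : row i e = tnth [tuple m; p; n; k] i.
  by apply/rowP => j; rewrite !mxE.
have rowe' i : row i e' = tnth [tuple p; m; k; n] i.
  by apply/rowP => j; rewrite !mxE.
have /mulmx1C <- : e *m (g *m e'^T) = 1%:M.
  apply/matrixP => i j; rewrite [RHS]mxE mulmxA.
  have -> : (e *m g *m e'^T) i j = bil g (row i e) (row j e').
    by rewrite /bil tr_row colE mulmxA -!row_mul -colE [RHS]mxE [RHS]mxE.
  rewrite rowe rowe'.
  by case: i => [[|[|[|[|//]]]] ?]; case: j => [[|[|[|[|//]]]] ?] /=;
    rewrite /tnth /= ?(mp, nk, mm, pp, nn, kk, mn, mk, pn, pk)// gC.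
apply/matrixP => a b; rewrite [RHS]mxE !big_ord_recl big_ord0 addr0.
have ent i : (g *m e'^T) a i = (g *m (tnth [tuple p; m; k; n] i)^T) a 0.
  by rewrite !mxE; apply: eq_bigr => j _; rewrite !mxE.
rewrite !ent !linmxE -!addrA; congr (_ + (_ + (_ + _)));
  by rewrite [LHS]mxE big_ord1 /e !mxE.
Qed.

Lemma frame_expand X :
  X = bil g X p *: m + bil g X m *: p + bil g X k *: n + bil g X n *: k.
Proof.
rewrite -[LHS]mulmx1 -frame_complete !mulmxDr !mulmxA.
by rewrite [in LHS](mx11_scalar (X *m g *m p^T))
  [in LHS](mx11_scalar (X *m g *m m^T))
  [in LHS](mx11_scalar (X *m g *m k^T)) [in LHS](mx11_scalar (X *m g *m n^T))
  !mul_scalar_mx.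
Qed.

Lemma frame_trace (A : 'M[F]_4) : \tr A =
  bil g (m *m A) p + bil g (p *m A) m + bil g (n *m A) k + bil g (k *m A) n.
Proof.
rewrite -[in LHS](mul1mx A) -frame_complete !mulmxDl !raddfD /=.
have E X Y : \tr (g *m X^T *m Y *m A) = bil g (Y *m A) X.
  rewrite -(mulmxA _ Y) mxtrace_mulC mulmxA.
  by rewrite [X in \tr X]mx11_scalar mxtrace_scalar mulr1n.
by rewrite !E.
Qed.

Variables (N : 'M[F]_4) (Rm : 'I_4 -> 'I_4 -> 'M[F]_4) (f : 'M[F]_4).
Hypothesis N_frame : (col_mx m k :=: N)%MS.
Hypotheses (Rm_anti : forall c d, Rm c d = - Rm d c)
  (Rm_bianchi : forall a b c d, Rm c d b a + Rm d b c a + Rm b c d a = 0)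
  (Rm_metric : forall c d, Rm c d *m g + g *m (Rm c d)^T = f c d *: g)
  (Rm_stable : forall (X : 'rV[F]_4) c d, (X <= N)%MS -> (X *m Rm c d <= N)%MS).
Hypothesis f_anti : f^T = - f.

Local Notation RM := (bext Rm).

Definition ric X Y : F :=
  bil (\matrix_(b, d) \sum_c Rm c d b c) X Y.

Let mN : (m <= N)%MS.
Proof. by rewrite -N_frame -addsmxE addsmxSl. Qed.

Let kN : (k <= N)%MS.
Proof. by rewrite -N_frame -addsmxE addsmxSr. Qed.

Lemma frame_span X : (X <= N)%MS -> exists u v, X = u *: m + v *: k.
Proof.
rewrite -N_frame => /submxP[D ->]; exists (D 0 (lshift 1 0)), (D 0 (rshift 1 0)).
rewrite -[in LHS](hsubmxK D) mul_row_col.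
rewrite [lsubmx D]mx11_scalar [rsubmx D]mx11_scalar !mul_scalar_mx.
by rewrite !mxE.
Qed.

Lemma frame_null X Y : (X <= N)%MS -> (Y <= N)%MS -> bil g X Y = 0.
Proof.
move=> /frame_span[u [v ->]] /frame_span[u' [v' ->]].
rewrite !(bilDl, bilDr, bilZl, bilZr) mm kk mk (gC k m) mk; ring.
Qed.

Let stable X Y Z : (Z <= N)%MS -> (Z *m RM X Y <= N)%MS.
Proof. by move=> ZN; apply: bext_stable => c d; exact: Rm_stable. Qed.

Let skew X Y Z W :
  bil g (Z *m RM X Y) W + bil g Z (W *m RM X Y) = bil f X Y * bil g Z W.
Proof.
have := bext_metric X Y Rm_metric; rewrite -bilE => H.
rewrite -bil_scalemx -H bil_addmx; congr (_ + _).
  by rewrite /bil !mulmxA.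
by rewrite /bil trmx_mul !mulmxA.
Qed.

Let bianchi X Y Z : Z *m RM X Y + X *m RM Y Z + Y *m RM Z X = 0.
Proof. exact: bext_bianchi. Qed.

(** In the Bianchi sum for [m], [k], [V] the other two terms are curvature operators applied to [m]
    and to [k]. They stay in [N], hence are orthogonal to [W]. *)
Lemma curv_pair V W : (W <= N)%MS ->
  bil g (V *m RM m k) W = 0.
Proof.
move=> WN; have /(congr1 (fun U => bil g U W)) := bianchi m k V.
rewrite !bilDl bil0l (frame_null (stable _ _ mN) WN).
by rewrite (frame_null (stable _ _ kN) WN) !addr0.
Qed.

(** Compatibility with the metric moves the operator from [X] to an arbitrary vector [W], where
    [curv_pair] removes it. Nondegeneracy then enters through [frame_expand]. *)
Lemma curv_frame X : (X <= N)%MS -> X *m RM m k = bil f m k *: X.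
Proof.
move=> XN.
have E W : bil g (X *m RM m k) W = bil f m k * bil g X W.
  by rewrite -skew [X in _ = _ + X]gC (curv_pair _ XN) addr0.
by rewrite [LHS]frame_expand !E [in RHS](frame_expand X) !scalerDr !scalerA.
Qed.

Let ricE X Y : ric X Y =
  bil g (X *m RM m Y) p + bil g (X *m RM p Y) m
  + bil g (X *m RM n Y) k + bil g (X *m RM k Y) n.
Proof.
(* The Ricci contraction is the trace of the endomorphism that sends [Z] to [X *m RM Z Y];
   [frame_trace] evaluates it in the null frame. *)
pose A : 'M[F]_4 := \matrix_(c, a) (X *m RM (delta_mx 0 c) Y) 0 a.
have AE Z : Z *m A = X *m RM Z Y.
  apply/rowP => a; rewrite mul_bextE mxE.
  under eq_bigr do rewrite mxE mul_bextE mulr_sumr.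
  rewrite exchange_big; apply: eq_bigr => b _ /=.
  under eq_bigr do rewrite mulr_sumr.
  rewrite exchange_big /=.
  apply: eq_bigr => c _; rewrite (bigD1 c)//= [X in _ + X]big1 ?addr0.
    by rewrite mulr_sumr; apply: eq_bigr => d _; rewrite !mxE !eqxx /=; ring.
  move=> c' c'c; rewrite big1 ?mulr0// => d _.
  by rewrite !mxE eqxx eq_sym (negbTE c'c) mulr0 !mul0r.
rewrite -!AE -frame_trace /ric bilE.
rewrite /mxtrace; under [RHS]eq_bigr do rewrite mxE mul_bextE.
rewrite [RHS]exchange_big; apply: eq_bigr => b _ /=.
under eq_bigr do rewrite mxE mulr_sumr.
rewrite [LHS]exchange_big /=; apply: eq_bigr => c _.
rewrite [RHS](bigD1 c)//= [X in _ = _ + X]big1 ?addr0.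
  by apply: eq_bigr => d _; rewrite !mxE !eqxx /=; ring.
move=> c' c'c; rewrite big1// => d _.
by rewrite !mxE eqxx (negbTE c'c) mulr0 !mul0r.
Qed.

Let RM_anti X Y : RM X Y = - RM Y X.
Proof. exact: bext_anti. Qed.

Let RM_alt X : RM X X = 0.
Proof. exact: bext_alt. Qed.

Let f_swap X Y : bil f X Y = - bil f Y X.
Proof. by rewrite -bil_oppmx -f_anti bil_trmx. Qed.

Let curv_m : m *m RM m k = bil f m k *: m.
Proof. exact: curv_frame. Qed.

Let curv_k : k *m RM m k = bil f m k *: k.
Proof. exact: curv_frame. Qed.

Let ric_null X Y Z W : (X <= N)%MS -> (W <= N)%MS -> bil g (X *m RM Z Y) W = 0.
Proof. by move=> XN WN; apply: frame_null => //; exact: stable. Qed.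

(** In [ricE] the summands paired with [m] or [k] vanish because [N] is stable and null. In the
    other two, both curvature arguments lie in [N], where the operator is a scalar. [ric_kk],
    [ric_mk] and [ric_km] follow in the same way. *)
Lemma ric_mm : ric m m = 0.
Proof.
rewrite ricE RM_alt mulmx0 bil0l
  (ric_null _ _ mN mN) (ric_null _ _ mN kN) (RM_anti k m).
by rewrite mulmxN bilNl curv_m bilZl mn mulr0 oppr0 !addr0.
Qed.

Lemma ric_kk : ric k k = 0.
Proof.
rewrite ricE RM_alt mulmx0 bil0l
  (ric_null _ _ kN mN) (ric_null _ _ kN kN) curv_k.
by rewrite bilZl (gC k p) pk mulr0 !addr0.
Qed.

Lemma ric_mk : ric m k = bil f m k.
Proof.
rewrite ricE RM_alt mulmx0 bil0l
  (ric_null _ _ mN mN) (ric_null _ _ mN kN) curv_m.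
by rewrite bilZl mp mulr1 !addr0.
Qed.

Lemma ric_km : ric k m = - bil f m k.
Proof.
rewrite ricE RM_alt mulmx0 bil0l
  (ric_null _ _ kN mN) (ric_null _ _ kN kN) (RM_anti k m).
by rewrite mulmxN bilNl curv_k bilZl (gC k n) nk mulr1 !addr0 add0r.
Qed.

Lemma ric_skew X Y : (X <= N)%MS -> (Y <= N)%MS -> ric X Y + ric Y X = 0.
Proof.
move=> /frame_span[u [v ->]] /frame_span[u' [v' ->]].
have := ric_mm; have := ric_kk; have := ric_mk; have := ric_km.
rewrite /ric !(bilDl, bilDr, bilZl, bilZr) => -> -> -> ->; ring.
Qed.

Lemma dform_vanishes (P : 'M[F]_4) :
  (forall X Y, (X <= N)%MS -> (Y <= N)%MS -> 2 * bil P X Y = ric X Y) ->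
  bil (RM m k *m P + P *m (RM m k)^T) m k = 0 -> bil f m k = 0.
Proof.
move=> PE.
have -> : bil (RM m k *m P + P *m (RM m k)^T) m k =
    bil P (m *m RM m k) k + bil P m (k *m RM m k).
  by rewrite bil_addmx /bil trmx_mul !mulmxA.
rewrite curv_m curv_k bilZl bilZr -mulrDr -[X in _ * (X + _)]mul1r.
rewrite -[X in _ * (_ + X)]mul1r -mulrDl PE// ric_mk => /eqP.
by rewrite mulf_eq0 orbb => /eqP.
Qed.

Section WeylPart.
Hypothesis f0 : bil f m k = 0.
Variables (Q : 'M[F]_4) (t : F).
Hypothesis QE : forall X Y,
  2 * bil Q X Y = ric X Y - 2^-1 * bil f X Y - t * bil g X Y.

(** The formula of [weyl_decomposition] evaluated on vectors. The curvature operator is applied to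
    [Y] because its matrix carries the second tensor index as row index. *)
Definition weyl_form X Y Z W : F :=
  bil g (Y *m RM Z W) X - 2^-1 * bil f Z W * bil g X Y
  - (bil g X Z * bil Q Y W - bil g X W * bil Q Y Z
     + bil g Y W * bil Q X Z - bil g Y Z * bil Q X W).

Let Qmk : bil Q m k = 0.
Proof.
by apply: (mulfI F2); rewrite QE ric_mk f0 mk !mulr0 !subr0.
Qed.

Let Qkm : bil Q k m = 0.
Proof.
apply: (mulfI F2); rewrite QE ric_km (f_swap k m) f0 (gC k m) mk.
by rewrite oppr0 !mulr0 !subr0.
Qed.

(** The coefficients of degree [0] and [1] of the principal quartic. *)
Lemma weyl_form_principal : weyl_form m k m k = 0 /\
  weyl_form n k m k - weyl_form m p m k + weyl_form m k n k - weyl_form m k m p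
  = 0.
Proof.
have mkmk : weyl_form m k m k = 0.
  by rewrite /weyl_form curv_k bilZl f0 mm kk mk (gC k m) mk; ring.
have mknk : weyl_form m k n k = 0.
  rewrite /weyl_form (ric_null _ _ kN mN) mk mn kk (gC k n) nk Qmk; ring.
have nkmk : weyl_form n k m k = 0.
  rewrite /weyl_form curv_k bilZl f0 Qkm kk (gC k m) mk (gC n m) mn; ring.
have mpmk : weyl_form m p m k = 0.
  rewrite /weyl_form (curv_pair _ mN) f0 mm mk pk Qmk; ring.
have mkmp : weyl_form m k m p = 0.
  rewrite /weyl_form (ric_null _ _ kN mN) mm mk Qkm (gC k p) pk (gC k m) mk.
  ring.
by rewrite mkmk mknk nkmk mpmk mkmp !subr0 addr0.
Qed.

End WeylPart.

End Frame.

(** * A parallel complex structure *)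

Section ParallelComplexStructure.
Variables (R : realType) (U : set 'rV[R]_4) (openU : open U).
Variables (G : coefficients R) (J : 'rV[R]_4 -> 'M[R]_4).
Hypotheses (sG : forall a b c, smooth_on U (G a b c)) (sJ : smooth_mx U J).
Hypothesis G_sym : forall x, U x -> forall a b c, G a b c x = G a c b x.
Hypothesis J_parallel : forall x, U x -> forall a b c, nabla_cs G J c a b x = 0.

Local Notation Gam := (connmx G).

Lemma covmx_cs c x : U x ->
  covmx Gam (fun c y => - Gam c y) c J x = 0.
Proof.
move=> Ux; apply/matrixP => b a; rewrite [RHS]mxE -(J_parallel Ux a b c).
rewrite /covmx mulmxN opprK !linmxE pdmxE /nabla_cs addrAC; congr (_ + _ - _).
  by rewrite mxE; apply: eq_bigr => e _; rewrite mxE mulrC.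
by rewrite mxE; apply: eq_bigr => e _; rewrite mxE.
Qed.

Lemma pd_cs c x : U x -> pdmx c J x = Gam c x *m J x - J x *m Gam c x.
Proof.
move=> Ux; have := covmx_cs c Ux.
rewrite /covmx mulmxN opprK => /eqP.
by rewrite addr_eq0 subr_eq => /eqP ->; rewrite addrC.
Qed.

(** Both second derivatives of the parallel [J] vanish, and what the commutator formula then says is
    that the curvature commutes with [J]. *)
Lemma curvmx_cs c d x : U x -> curvmx G c d x *m J x = J x *m curvmx G c d x.
Proof.
move=> Ux; have sC e : smooth_mx U (Gam e) by exact: smooth_connmx.
have sC' e : smooth_mx U (fun y => - Gam e y) by exact: smooth_mxN.
have := covmx_commutator openU sC sC' c d sJ Ux.
have Z e h : covmx Gam (fun c y => - Gam c y) e
    (covmx Gam (fun c y => - Gam c y) h J) x = 0.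
  have covE T : covmx Gam (fun c y => - Gam c y) e T x =
    pdmx e T x - Gam e x *m T x - T x *m (- Gam e x) by [].
  rewrite covE covmx_cs// mulmx0 mul0mx !subr0.
  by rewrite (pdmx_congr openU e (fun y Uy => covmx_cs h Uy) Ux) pdmx_cst.
rewrite !Z subrr !(pdmxN _ (sC _) Ux) => /esym/eqP.
rewrite oppr_eq0 addr_eq0 -curvmxE => /eqP ->; rewrite -mulmxN curvmxE.
congr (_ *m _); mxlinear.
Qed.

(** [pd_cs] absorbs the derivatives of the two factors [J]. The invariance is assumed and concluded
    on all of [U], since it gets differentiated here and once more in [cov2mx_invariant]. *)
Lemma cov2_invariant (K : 'rV[R]_4 -> 'M[R]_4) c : smooth_mx U K ->
  (forall x, U x -> K x = J x *m K x *m (J x)^T) ->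
  forall x, U x -> cov2 G c K x = J x *m cov2 G c K x *m (J x)^T.
Proof.
move=> sK KJ x Ux.
have dK : pdmx c K x = pdmx c J x *m K x *m (J x)^T + J x *m pdmx c K x *m (J x)^T
    + J x *m K x *m (pdmx c J x)^T.
  rewrite [LHS](pdmx_congr openU c KJ Ux).
  rewrite (pdmxM c (smooth_mxM openU sJ sK) (smooth_mx_tr sJ) Ux).
  by rewrite (pdmxM c sJ sK Ux) pdmx_tr mulmxDl.
have covE : cov2 G c K x = pdmx c K x - Gam c x *m K x - K x *m (Gam c x)^T by [].
rewrite [LHS]covE dK pd_cs// [in X in _ - X - _](KJ x Ux) [in X in _ - X](KJ x Ux).
rewrite covE linearB /= !trmx_mul.
move: (pdmx c K x) ((Gam c x)^T) ((J x)^T) => *; mxlinear.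
Qed.

(** The sum accounts for the inner direction index [c], which [cov2] ignores; this makes it the true
    second covariant derivative. *)
Definition cov2mx d c (T : 'rV[R]_4 -> 'M[R]_4) x : 'M[R]_4 :=
  cov2 G d (cov2 G c T) x - \sum_e G e c d x *: cov2 G e T x.

Lemma cov2mxE d c T x i j : cov2mx d c T x i j =
  cov2 G d (cov2 G c T) x i j - \sum_e G e c d x * cov2 G e T x i j.
Proof.
rewrite [LHS]addmxE; congr (_ + _); rewrite [LHS]oppmxE summxE.
by congr (- _); apply: eq_bigr => e _; rewrite [LHS]scalemxE.
Qed.

Lemma smooth_cov2 c (T : 'rV[R]_4 -> 'M[R]_4) :
  smooth_mx U T -> smooth_mx U (cov2 G c T).
Proof.
move=> sT; have sC e : smooth_mx U (Gam e) by exact: smooth_connmx.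
by apply: smooth_covmx => // e; exact: smooth_mx_tr.
Qed.

Lemma cov2D c (S T : 'rV[R]_4 -> 'M[R]_4) x :
  smooth_mx U S -> smooth_mx U T -> U x ->
  cov2 G c (fun y => S y + T y) x = cov2 G c S x + cov2 G c T x.
Proof.
by move=> sS sT Ux; rewrite /cov2 /covmx (pdmxD c sS sT Ux); mxlinear.
Qed.

Lemma cov2_tr c (T : 'rV[R]_4 -> 'M[R]_4) x :
  cov2 G c (fun y => (T y)^T) x = (cov2 G c T x)^T.
Proof.
rewrite /cov2 /covmx pdmx_tr !linearB /= !trmx_mul trmxK.
by rewrite addrAC.
Qed.

Lemma cov2_congr c (S T : 'rV[R]_4 -> 'M[R]_4) x :
  (forall y, U y -> S y = T y) -> U x -> cov2 G c S x = cov2 G c T x.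
Proof.
by move=> ST Ux; rewrite /cov2 /covmx (pdmx_congr openU c ST Ux) ST.
Qed.

Lemma cov2mx_sym d c (T : 'rV[R]_4 -> 'M[R]_4) x : smooth_mx U T -> U x ->
  cov2mx d c (fun y => T y + (T y)^T) x =
  cov2mx d c T x + (cov2mx d c T x)^T.
Proof.
move=> sT Ux; have sTt := smooth_mx_tr sT.
have E e y : U y ->
    cov2 G e (fun y => T y + (T y)^T) y = cov2 G e T y + (cov2 G e T y)^T.
  by move=> Uy; rewrite (cov2D e sT sTt Uy) cov2_tr.
have s1 := smooth_cov2 c sT.
rewrite /cov2mx (cov2_congr d (fun y Uy => E c y Uy) Ux).
rewrite (cov2D d s1 (smooth_mx_tr s1) Ux) cov2_tr.
under eq_bigr do rewrite E// scalerDr.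
have trB (X Y : 'M[R]_4) : (X - Y)^T = X^T - Y^T by rewrite linearB.
have ACA (A A' S S' : 'M[R]_4) : A + A' - (S + S') = (A - S) + (A' - S').
  by rewrite opprD addrACA.
rewrite big_split /= (trB (cov2 G d (cov2 G c T) x)) ACA; congr (_ + (_ - _)).
by rewrite raddf_sum; apply: eq_bigr => e _; rewrite /= linearZ.
Qed.

Lemma cov2mx_invariant d c (K : 'rV[R]_4 -> 'M[R]_4) : smooth_mx U K ->
  (forall x, U x -> K x = J x *m K x *m (J x)^T) ->
  forall x, U x -> cov2mx d c K x = J x *m cov2mx d c K x *m (J x)^T.
Proof.
move=> sK KJ x Ux; have H e := cov2_invariant e sK KJ.
rewrite /cov2mx mulmxBr mulmxBl.
rewrite -(cov2_invariant d (smooth_cov2 c sK) (H c) Ux); congr (_ - _).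
rewrite mulmx_sumr mulmx_suml; apply: eq_bigr => e _.
by rewrite -scalemxAr -scalemxAl -H.
Qed.

(** The corrections for the direction index cancel by symmetry of [G], so the Ricci identity has no
    torsion term. *)
Lemma cov2mx_commutator d c (T : 'rV[R]_4 -> 'M[R]_4) x :
  smooth_mx U T -> U x ->
  cov2mx d c T x - cov2mx c d T x =
  - (curvmx G d c x *m T x + T x *m (curvmx G d c x)^T).
Proof.
move=> sT Ux; rewrite -(cov2_commutator openU sG d c sT Ux) /cov2mx.
under [in X in _ - X]eq_bigr do rewrite (G_sym Ux).
by rewrite opprB addrA subrK.
Qed.

(** Of the three Christoffel terms in [nabla3], two act on the indices of [P] and one on the
    direction of the inner derivative. The indices [b] and [c] exchange these roles between the two
    summands of [cotton]. *)
Lemma nabla3_cotton (g : 'rV[R]_4 -> 'M[R]_4) d a b c x :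
  let P y := \matrix_(a, b) schouten g G a b y in
  smooth_mx U P -> U x ->
  nabla3 G (cotton g G) d a b c x =
  cov2mx d b P x c a - cov2mx d c P x b a.
Proof.
move=> P sP Ux.
have cotE i j k y : cotton g G i j k y = cov2 G j P y k i - cov2 G k P y j i.
  by rewrite /cotton !nabla2E.
have sc e := smooth_cov2 e sP.
have cov2E e T i j : cov2 G e T x i j = pd e (fun y => T y i j) x
    - \sum_h G h i e x * T x h j - \sum_h G h j e x * T x i h.
  rewrite [LHS]addmxE [X in X + _ = _]addmxE [X in _ + X = _]oppmxE.
  rewrite [X in _ + X - _]oppmxE pdmxE; congr (_ - _ - _).
    by rewrite mxE; apply: eq_bigr => h _; rewrite mxE.
  by rewrite mxE; apply: eq_bigr => h _; rewrite !mxE mulrC.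
rewrite /nabla3.
have -> : pd d (cotton g G a b c) x =
    pd d (fun y => cov2 G b P y c a) x - pd d (fun y => cov2 G c P y b a) x.
  have -> : cotton g G a b c = fun y => cov2 G b P y c a - cov2 G c P y b a.
    by apply/funext => y; rewrite cotE.
  by rewrite pdB//; exact: smooth_mx_diff (sc _) Ux.
rewrite !cov2mxE !(cov2E d).
have cE (F : 'I_4 -> R) i j k : \sum_e F e * cotton g G (i e) (j e) (k e) x =
    \sum_e F e * cov2 G (j e) P x (k e) (i e)
    - \sum_e F e * cov2 G (k e) P x (j e) (i e).
  by rewrite -sumrB; apply: eq_bigr => e _; rewrite cotE mulrBr.
rewrite (cE _ id (fun=> b) (fun=> c)) (cE _ (fun=> a) id (fun=> c)).
rewrite (cE _ (fun=> a) (fun=> b) id); ring.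
Qed.

End ParallelComplexStructure.

(** * Existence of adapted frames *)

Section FrameExistence.
Variables (F : fieldType) (F2 : (2 : F) != 0) (im : F) (im2 : im * im = -1).
Variables (g J : 'M[F]_4).
Hypotheses (g_sym : g^T = g) (g_unit : g \in unitmx).
Hypotheses (J2 : J *m J = - 1%:M) (gJ : J *m g *m J^T = g).

Lemma eigen_null (h : 'M[F]_4) (a : F) (X Y : 'rV[F]_4) :
  J *m h *m J^T = h -> a * a = -1 ->
  X *m J = a *: X -> Y *m J = a *: Y -> bil h X Y = 0.
Proof.
move=> hJ a2 XJ YJ; apply: (mulfI F2); rewrite mulr0.
have E : bil h X Y = - bil h X Y.
  rewrite -[in LHS]hJ.
  have -> : bil (J *m h *m J^T) X Y = bil h (X *m J) (Y *m J).
    by rewrite /bil trmx_mul !mulmxA.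
  by rewrite XJ YJ bilZl bilZr mulrA a2 mulN1r.
by rewrite mulr_natl mulr2n {1}E addNr.
Qed.

Lemma eigen_null_mx (a : F) r s (A : 'M[F]_(r, 4)) (B : 'M[F]_(s, 4)) :
  a * a = -1 ->
  (A <= eigenspace J a)%MS -> (B <= eigenspace J a)%MS -> A *m g *m B^T = 0.
Proof.
move=> a2 /eigenspaceP AJ /eigenspaceP BJ; apply/matrixP => i j.
have -> : (A *m g *m B^T) i j = bil g (row i A) (row j B).
  by rewrite /bil tr_row colE mulmxA -!row_mul -colE [RHS]mxE [RHS]mxE.
rewrite mxE; apply: (eigen_null gJ a2).
- by rewrite -row_mul AJ linearZ.
- by rewrite -row_mul BJ linearZ.
Qed.

(** A totally null subspace for a nondegenerate form has at most half the dimension. *)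
Lemma eigen_rank_le (a : F) : a * a = -1 -> (\rank (eigenspace J a) <= 2)%N.
Proof.
move=> a2; have := mulmx0_rank_max (eigen_null_mx a2 (submx_refl _) (submx_refl _)).
rewrite mxrank_tr mxrankMfree ?row_free_unit// => H.
by rewrite -(leq_pmul2l (m := 2))// mul2n -addnn.
Qed.

Lemma eigen_sum : (1%:M <= eigenspace J im + eigenspace J (- im))%MS.
Proof.
(* The two summands are the projections onto the eigenspaces of [im] and [- im]. *)
have -> : 1%:M = 2^-1 *: (1%:M - im *: J) + 2^-1 *: (1%:M + im *: J).
  rewrite -scalerDr addrACA addNr addr0 -mulr2n -scaler_nat scalerA mulVf//.
  by rewrite scale1r.
rewrite addmx_sub_adds// scalemx_sub//; apply/eigenspaceP.
- by rewrite mulmxBl mul1mx -scalemxAl J2 scalerBr scalerA im2 scalerN opprK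
    scaleN1r opprK addrC.
- by rewrite mulmxDl mul1mx -scalemxAl J2 scalerDr scalerA mulNr im2 opprK
    scale1r scalerN scaleNr addrC.
Qed.

Let im2N : (- im) * (- im) = -1. Proof. by rewrite mulrNN. Qed.

Lemma eigen_rank : \rank (eigenspace J im) = 2 /\ \rank (eigenspace J (- im)) = 2.
Proof.
have le4 := leq_trans (mxrankS eigen_sum) (mxrank_adds_leqif _ _).
rewrite mxrank1 in le4.
have r1 := eigen_rank_le im2; have r2 := eigen_rank_le im2N.
move: le4 r1 r2.
move: (\rank (eigenspace J im)) (\rank (eigenspace J (- im))) => r s le4 r1 r2.
have e4 : (r + s = 4)%N.
  by apply/eqP; rewrite eqn_leq le4 andbT; exact: (leq_add r1 r2).
split; apply/eqP; rewrite eqn_leq ?r1 ?r2 /=.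
- by rewrite -(leq_add2r s) e4 (leq_add2l 2 s 2).
- by rewrite -(leq_add2l r) e4 (leq_add2r 2 r 2).
Qed.

(** The metric pairs the two null eigenspaces perfectly: [m], [k] form a basis of one, and [p], [n]
    the dual basis in the other. *)
Lemma frame_exists : exists m p n k : 'rV[F]_4,
  [/\ bil g m p = 1 /\ bil g n k = 1,
      [/\ bil g m m = 0, bil g p p = 0, bil g n n = 0 & bil g k k = 0],
      [/\ bil g m n = 0, bil g m k = 0, bil g p n = 0 & bil g p k = 0] &
      (col_mx m k :=: eigenspace J im)%MS].
Proof.
have [rk rk'] := eigen_rank.
have basis r (A : 'M[F]_4) : \rank A = r ->
    exists B : 'M[F]_(r, 4), (B :=: A)%MS /\ row_free B.
  move=> <-; exists (row_base A); split; first exact: eq_row_base.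
  exact: row_base_free.
have [B [BN Bfree]] := basis _ _ rk; have [B' [BN' _]] := basis _ _ rk'.
have BB : B *m g *m B^T = 0 by apply: (eigen_null_mx im2); rewrite BN.
have B'B' : B' *m g *m B'^T = 0 by apply: (eigen_null_mx im2N); rewrite BN'.
pose W := B *m g *m B'^T.
(* A combination of the rows of [B] killed by [W] is orthogonal to both eigenspaces, hence to the
   whole space, hence zero. *)
have Wfree : row_free W.
  rewrite -kermx_eq0; apply/eqP; have vW := mulmx_ker W.
  apply: (row_free_inj Bfree); rewrite mul0mx.
  have gfree : row_free g by rewrite row_free_unit.
  apply: (row_free_inj gfree); rewrite mul0mx.
  have : (1%:M <= col_mx B B')%MS.
    by apply: submx_trans eigen_sum _; rewrite -addsmxE addsmxS ?BN ?BN'.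
  case/submxP => E /(congr1 trmx); rewrite trmx1 trmx_mul tr_col_mx => E1.
  have z1 : kermx W *m B *m g *m B^T = 0.
    by rewrite -2!(mulmxA (kermx W)) BB mulmx0.
  have z2 : kermx W *m B *m g *m B'^T = 0 by rewrite -2!(mulmxA (kermx W)).
  by rewrite -[LHS]mulmx1 E1 mulmxA mul_mx_row z1 z2 row_mx0 mul0mx.
have Wu : W \in unitmx by rewrite -row_free_unit.
(* This change of basis makes the rows of [B'] dual to those of [B]. *)
pose D := (invmx W)^T *m B'.
have WD : B *m g *m D^T = 1%:M by rewrite trmx_mul trmxK mulmxA mulmxV.
have DD : D *m g *m D^T = 0.
  transitivity ((invmx W)^T *m (B' *m g *m B'^T) *m ((invmx W)^T)^T).
    by rewrite [D^T]trmx_mul !mulmxA.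
  by rewrite B'B' mulmx0 mul0mx.
have ent r s (A : 'M[F]_(r, 4)) (A' : 'M[F]_(s, 4)) i j :
    bil g (row i A) (row j A') = (A *m g *m A'^T) i j.
  by rewrite /bil tr_row colE mulmxA -!row_mul -colE [LHS]mxE [LHS]mxE.
exists (row 0 B), (row 0 D), (row 1 D), (row 1 B).
have gC := bilC _ _ g_sym.
split; first by split; rewrite ?(gC (row 1 D)) ent WD mxE.
- by split; rewrite ent ?BB ?DD mxE.
- by split; rewrite ?(gC (row 0 D) (row 1 B)) ent ?WD ?BB ?DD mxE.
suff -> : col_mx (row 0 B) (row 1 B) = B by [].
apply/row_matrixP => i; case: (@split_ordP 1 1 i) => j ->; rewrite (ord1 j).
  by rewrite rowKu row_id; congr (row _ B); apply: val_inj.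
by rewrite rowKd row_id; congr (row _ B); apply: val_inj.
Qed.

End FrameExistence.

(** * Multilinearity of [eval4], for complex and for polynomial arguments *)

Section MultilinearExtension.
Variables (R : nzRingType) (S : comNzRingType) (f : {additive R -> S}).
Implicit Types (T : 'I_4 -> 'I_4 -> 'I_4 -> 'I_4 -> R) (X Y Z W : 'rV[S]_4).

Local Notation E := (eval4 f).

(** Transpositions of neighbouring slots carry linearity from the first slot to all others. *)
Lemma eval4_swap12 T X Y Z W :
  E T X Y Z W = E (fun b a c d => T a b c d) Y X Z W.
Proof.
rewrite /eval4 exchange_big; apply: eq_bigr => b _; apply: eq_bigr => a _ /=.
by apply: eq_bigr => c _; apply: eq_bigr => d _; ring.
Qed.

Lemma eval4_swap23 T X Y Z W :
  E T X Y Z W = E (fun a c b d => T a b c d) X Z Y W.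
Proof.
apply: eq_bigr => a _; rewrite exchange_big; apply: eq_bigr => c _ /=.
by apply: eq_bigr => b _; apply: eq_bigr => d _; ring.
Qed.

Lemma eval4_swap34 T X Y Z W :
  E T X Y Z W = E (fun a b d c => T a b c d) X Y W Z.
Proof.
apply: eq_bigr => a _; apply: eq_bigr => b _.
rewrite exchange_big; apply: eq_bigr => d _ /=.
by apply: eq_bigr => c _; ring.
Qed.

Lemma eval4Dl T X X' Y Z W : E T (X + X') Y Z W = E T X Y Z W + E T X' Y Z W.
Proof.
rewrite /eval4 -big_split; apply: eq_bigr => a _ /=; rewrite -big_split.
apply: eq_bigr => b _ /=; rewrite -big_split; apply: eq_bigr => c _ /=.
by rewrite -big_split; apply: eq_bigr => d _ /=; rewrite mxE; ring.
Qed.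

Lemma eval4Zl T k X Y Z W : E T (k *: X) Y Z W = k * E T X Y Z W.
Proof.
rewrite /eval4 mulr_sumr; apply: eq_bigr => a _ /=; rewrite mulr_sumr.
apply: eq_bigr => b _ /=; rewrite mulr_sumr; apply: eq_bigr => c _ /=.
by rewrite mulr_sumr; apply: eq_bigr => d _ /=; rewrite mxE; ring.
Qed.

Lemma eval4DZ1 T k X X' Y Z W :
  E T (X + k *: X') Y Z W = E T X Y Z W + k * E T X' Y Z W.
Proof. by rewrite eval4Dl eval4Zl. Qed.

Lemma eval4DZ2 T k X X' Y Z W :
  E T Y (X + k *: X') Z W = E T Y X Z W + k * E T Y X' Z W.
Proof. by rewrite !(eval4_swap12 T) eval4DZ1. Qed.

Lemma eval4DZ3 T k X X' Y Z W :
  E T Y Z (X + k *: X') W = E T Y Z X W + k * E T Y Z X' W.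
Proof. by rewrite !(eval4_swap23 T) eval4DZ2. Qed.

Lemma eval4DZ4 T k X X' Y Z W :
  E T Y Z W (X + k *: X') = E T Y Z W X + k * E T Y Z W X'.
Proof. by rewrite !(eval4_swap34 T) eval4DZ3. Qed.

Lemma eval4D T T' X Y Z W :
  E (fun a b c d => T a b c d + T' a b c d) X Y Z W = E T X Y Z W + E T' X Y Z W.
Proof.
rewrite /eval4 -big_split; apply: eq_bigr => a _ /=; rewrite -big_split.
apply: eq_bigr => b _ /=; rewrite -big_split; apply: eq_bigr => c _ /=.
by rewrite -big_split; apply: eq_bigr => d _ /=; rewrite raddfD; ring.
Qed.

Lemma eval4N T X Y Z W :
  E (fun a b c d => - T a b c d) X Y Z W = - E T X Y Z W.
Proof.
rewrite /eval4 -sumrN; apply: eq_bigr => a _ /=; rewrite -sumrN.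
apply: eq_bigr => b _ /=; rewrite -sumrN; apply: eq_bigr => c _ /=.
by rewrite -sumrN; apply: eq_bigr => d _ /=; rewrite raddfN; ring.
Qed.

End MultilinearExtension.

(** * Complexified tensors *)

Section Complexification.
Variable R : realType.
Implicit Types (T : 'I_4 -> 'I_4 -> 'I_4 -> 'I_4 -> R) (X Y Z W : 'rV[R[i]]_4).
Implicit Types A K g f Q : 'M[R]_4.

Definition cmx m n (A : 'M[R]_(m, n)) : 'M[R[i]]_(m, n) :=
  map_mx (real_complex R) A.

Lemma eval4C_swap12 T X Y Z W :
  eval4C T X Y Z W = eval4C (fun b a c d => T a b c d) Y X Z W.
Proof. exact: (eval4_swap12 (real_complex R)). Qed.

Lemma eval4C_swap23 T X Y Z W :
  eval4C T X Y Z W = eval4C (fun a c b d => T a b c d) X Z Y W.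
Proof. exact: (eval4_swap23 (real_complex R)). Qed.

Lemma eval4C_swap34 T X Y Z W :
  eval4C T X Y Z W = eval4C (fun a b d c => T a b c d) X Y W Z.
Proof. exact: (eval4_swap34 (real_complex R)). Qed.

Lemma eval4CD T T' X Y Z W :
  eval4C (fun a b c d => T a b c d + T' a b c d) X Y Z W =
  eval4C T X Y Z W + eval4C T' X Y Z W.
Proof. exact: (eval4D (real_complex R)). Qed.

Lemma eval4CB T T' X Y Z W :
  eval4C (fun a b c d => T a b c d - T' a b c d) X Y Z W =
  eval4C T X Y Z W - eval4C T' X Y Z W.
Proof.
rewrite (eval4CD T (fun a b c d => - T' a b c d)); congr (_ + _).
exact: (eval4N (real_complex R)).
Qed.

Lemma bil_sum (I : Type) (r : seq I) (G : I -> 'M[R[i]]_4) X Y :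
  bil (\sum_(j <- r) G j) X Y = \sum_(j <- r) bil (G j) X Y.
Proof. by rewrite /bil mulmx_sumr mulmx_suml summxE. Qed.

Lemma bil_bext (T : 'I_4 -> 'I_4 -> 'M[R[i]]_4) X Y Z W :
  bil (bext T Z W) X Y = \sum_c \sum_d Z 0 c * W 0 d * bil (T c d) X Y.
Proof.
rewrite /bext bil_sum; apply: eq_bigr => c _; rewrite bil_sum.
by apply: eq_bigr => d _; rewrite bil_scalemx.
Qed.

Lemma eval4C_bext (T : 'I_4 -> 'I_4 -> 'M[R]_4) X Y Z W :
  eval4C (fun c d a b => T c d a b) Z W X Y =
  bil (bext (fun c d => cmx (T c d)) Z W) X Y.
Proof.
rewrite bil_bext; apply: eq_bigr => c _; apply: eq_bigr => d _.
rewrite bilE mulr_sumr; apply: eq_bigr => a _; rewrite mulr_sumr.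
by apply: eq_bigr => b _; rewrite mxE; ring.
Qed.

Lemma eval4C_mul A K X Y Z W :
  eval4C (fun a b c d => A a b * K c d) X Y Z W =
  bil (cmx A) X Y * bil (cmx K) Z W.
Proof.
have -> : (fun a b c d => A a b * K c d) = (fun a b c d => (A a b *: K) c d).
  by apply/funext => a; apply/funext => b; apply/funext => c; apply/funext => d;
    rewrite mxE.
rewrite (eval4C_bext (fun a b => A a b *: K)) bil_bext bilE mulr_suml.
apply: eq_bigr => a _; rewrite mulr_suml; apply: eq_bigr => b _.
have -> : cmx (A a b *: K) = (A a b)%:C *: cmx K by rewrite /cmx map_mxZ.
by rewrite bil_scalemx mxE; ring.
Qed.

Lemma eval4C_weyl T (Rm : 'I_4 -> 'I_4 -> 'M[R]_4) g f Q X Y Z W :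
  (forall a b c d, T a b c d =
     (Rm c d *m g) b a - 2^-1 * f c d * g a b - kn g Q a b c d) ->
  eval4C T X Y Z W =
  weyl_form (cmx g) (fun c d => cmx (Rm c d)) (cmx f) (cmx Q) X Y Z W.
Proof.
move=> TE.
have -> : T = (fun a b c d => (Rm c d *m g) b a - g a b * (2^-1 *: f) c d
    - (g a c * Q b d - g a d * Q b c + Q a c * g b d - Q a d * g b c)).
  apply/funext => a; apply/funext => b; apply/funext => c; apply/funext => d.
  by rewrite TE /kn !linmxE; ring.
rewrite eval4CB eval4CB eval4CB eval4CD eval4CB /weyl_form.
congr (_ - _ - (_ - _ + _ - _)).
(* The transpositions bring the arguments into the order [Z], [W], [Y], [X] required by
   [eval4C_bext]. *)
- rewrite eval4C_swap23 eval4C_swap12 eval4C_swap34 eval4C_swap23 eval4C_swap34.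
  rewrite (eval4C_bext (fun c d => Rm c d *m g)) bil_bext.
  have -> : bil (cmx g) (Y *m bext (fun c d => cmx (Rm c d)) Z W) X =
      bil (bext (fun c d => cmx (Rm c d)) Z W *m cmx g) Y X.
    by rewrite /bil !mulmxA.
  have -> : bext (fun c d => cmx (Rm c d)) Z W *m cmx g =
      bext (fun c d => cmx (Rm c d) *m cmx g) Z W.
    rewrite /bext mulmx_suml; apply: eq_bigr => c _; rewrite mulmx_suml.
    by apply: eq_bigr => d _; rewrite -scalemxAl.
  rewrite bil_bext; apply: eq_bigr => c _; apply: eq_bigr => d _.
  by rewrite /cmx map_mxM.
- rewrite eval4C_mul /cmx map_mxZ bil_scalemx mulrC; congr (_ * _ * _).
  by rewrite /= fmorphV /= rmorph_nat.
- by rewrite eval4C_swap23 eval4C_mul.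
- by rewrite eval4C_swap34 eval4C_swap23 eval4C_mul.
- by rewrite eval4C_swap23 eval4C_mul mulrC.
- by rewrite eval4C_swap34 eval4C_swap23 eval4C_mul mulrC.
Qed.

(** The hypotheses are the coefficients of degree 0 and 1: the four terms of the second take the
    variable from one slot each, with the minus sign of k - z p in slots 2 and 4. *)
Lemma quartic_double_root T (m p n k : 'rV[R[i]]_4) :
  eval4C T m k m k = 0 ->
  eval4C T n k m k - eval4C T m p m k + eval4C T m k n k - eval4C T m k m p = 0 ->
  multiple_root (principal_quartic T m p n k) 0.
Proof.
move=> T0 T1.
pose f := [the {additive R -> {poly R[i]}} of polyC \o real_complex R].
pose E := eval4 f T; pose c (X : 'rV[R[i]]_4) := map_mx polyC X.
have EC X Y Z W : E (c X) (c Y) (c Z) (c W) = (eval4C T X Y Z W)%:P.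
  rewrite /E /eval4C /eval4 rmorph_sum; apply: eq_bigr => a _.
  rewrite rmorph_sum; apply: eq_bigr => b _; rewrite rmorph_sum.
  apply: eq_bigr => e _; rewrite rmorph_sum; apply: eq_bigr => d _.
  by rewrite !rmorphM /= !mxE.
have -> : principal_quartic T m p n k =
    E (c m + 'X *: c n) (c k + (- 'X) *: c p) (c m + 'X *: c n)
      (c k + (- 'X) *: c p) by rewrite scaleNr.
rewrite /E !(eval4DZ1, eval4DZ2, eval4DZ3, eval4DZ4) -/E !EC T0.
have T1' : (eval4C T n k m k)%:P = (eval4C T m p m k)%:P
    - (eval4C T m k n k)%:P + (eval4C T m k m p)%:P :> {poly R[i]}.
  rewrite -polyCB -polyCD; congr (_%:P); apply/eqP; rewrite -subr_eq0.
  by apply/eqP; rewrite -[RHS]T1; ring.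
rewrite /multiple_root subr0 T1'.
move: (polyC (eval4C T m p m k)) (polyC (eval4C T m k n k))
  (polyC (eval4C T m k m p)) (polyC (eval4C T n p m k))
  (polyC (eval4C T n k n k)) (polyC (eval4C T n k m p))
  (polyC (eval4C T m p n k)) (polyC (eval4C T m p m p))
  (polyC (eval4C T m k n p)) (polyC (eval4C T n p n k))
  (polyC (eval4C T n p m p)) (polyC (eval4C T n k n p))
  (polyC (eval4C T m p n p)) (polyC (eval4C T n p n p))
  => e1 e2 e3 npmk nknk nkmp mpnk mpmp mknp npnk npmp nknp mpnp npnp.
rewrite [X in _ %| X](_ : _ = 'X ^+ 2 *
  (- npmk + nknk - nkmp - mpnk + mpmp - mknp
   + 'X * (npmp + mpnp - npnk - nknp) + 'X ^+ 2 * npnp)).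
  exact: dvdp_mulr.
by rewrite polyC0; ring.
Qed.

End Complexification.

(** * The theorem *)

Section Chart.
Variables (R : realType) (U : set 'rV[R]_4) (openU : open U).
Variables (g J : 'rV[R]_4 -> 'M[R]_4) (B : 'rV[R]_4 -> 'rV[R]_4)
  (G : coefficients R).
Hypotheses (sg : smooth_mx U g) (sB : smooth_mx U B) (sJ : smooth_mx U J)
  (sG : forall a b c, smooth_on U (G a b c)).
Hypotheses (g_sym : forall x, U x -> (g x)^T = g x)
  (g_unit : forall x, U x -> g x \in unitmx)
  (J2 : forall x, U x -> J x *m J x = - 1%:M)
  (gJ : forall x, U x -> J x *m g x *m (J x)^T = g x).
Hypotheses (G_sym : forall x, U x -> forall a b c, G a b c x = G a c b x)
  (G_weyl : forall x, U x -> forall c, cov2 G c g x = - B x 0 c *: g x)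
  (J_parallel : forall x, U x -> forall a b c, nabla_cs G J c a b x = 0).

Implicit Types X Y Z W : 'rV[R[i]]_4.

Let i2 : ('i : R[i]) * 'i = -1.
Proof. by rewrite -expr2 sqr_i. Qed.

Let two : (2 : R[i]) != 0.
Proof. by rewrite pnatr_eq0. Qed.

Let Rc x c d := cmx (curvmx G c d x).
Let Fm x : 'M[R]_4 := \matrix_(c, d) dform B c d x.
Let Ric x : 'M[R]_4 := \matrix_(b, d) ricci G b d x.
Let P x : 'M[R]_4 := \matrix_(a, b) schouten g G a b x.

Let T10P x X : reflect (X *m cmx (J x) = 'i *: X) (X <= T10 (J x))%MS.
Proof. exact: eigenspaceP. Qed.

Let curv_anti c d x : Rc x c d = - Rc x d c.
Proof.
rewrite /Rc /cmx -map_mxN; congr (map_mx _ _).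
by rewrite !curvmxE; mxlinear.
Qed.

Let curv_bianchi x : U x -> forall a b c d,
  Rc x c d b a + Rc x d b c a + Rc x b c d a = 0.
Proof.
move=> Ux a b c d; rewrite !mxE -!rmorphD -[RHS](rmorph0 (real_complex R)).
congr (real_complex R _); rewrite /curvature.
have E i j k : pd i (G a j k) x = pd i (G a k j) x.
  by apply: (pd_congr openU) => // y Uy; exact: G_sym.
rewrite (E c d b) (E d c b) (E b d c).
transitivity (\sum_e (G a e c x * G e b d x - G a e d x * G e b c x)
  + (\sum_e (G a e d x * G e c b x - G a e b x * G e c d x)
  + \sum_e (G a e b x * G e d c x - G a e c x * G e d b x))); first by ring.
rewrite -!big_split; apply: big1 => e _ /=.
by rewrite (G_sym Ux e b d) (G_sym Ux e c b) (G_sym Ux e d c); ring.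
Qed.

Let curv_metric x : U x -> forall c d,
  Rc x c d *m cmx (g x) + cmx (g x) *m (Rc x c d)^T = cmx (Fm x) c d *: cmx (g x).
Proof.
move=> Ux c d.
rewrite /Rc /cmx matrix.map_trmx -!map_mxM -map_mxD [in RHS]mxE -map_mxZ mxE.
congr (map_mx _ _).
exact: (curvmx_metric openU sg sB sG G_weyl).
Qed.

Let curv_stable x : U x -> forall (X : 'rV[R[i]]_4) c d,
  (X <= T10 (J x))%MS -> (X *m Rc x c d <= T10 (J x))%MS.
Proof.
move=> Ux X c d /T10P XJ; apply/T10P.
have JR : Rc x c d *m cmx (J x) = cmx (J x) *m Rc x c d.
  rewrite /Rc /cmx -!map_mxM; congr (map_mx _ _).
  exact: (curvmx_cs openU sG sJ J_parallel).
by rewrite -mulmxA JR mulmxA XJ -scalemxAl.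
Qed.

Let Fm_anti x : (cmx (Fm x))^T = - cmx (Fm x).
Proof.
rewrite /cmx matrix.map_trmx -map_mxN; congr (map_mx _ _).
by apply/matrixP => c d; rewrite !mxE /dform opprB.
Qed.

Let cg_sym x : U x -> (cmx (g x))^T = cmx (g x).
Proof. by move=> Ux; rewrite /cmx matrix.map_trmx g_sym. Qed.

Let cgJ (h : 'M[R]_4) x : J x *m h *m (J x)^T = h ->
  cmx (J x) *m cmx h *m (cmx (J x))^T = cmx h.
Proof. by move=> hJ; rewrite /cmx matrix.map_trmx -!map_mxM hJ. Qed.

Lemma T10_null (h : 'M[R]_4) x X Y : J x *m h *m (J x)^T = h ->
  (X <= T10 (J x))%MS -> (Y <= T10 (J x))%MS -> bil (cmx h) X Y = 0.
Proof.
by move=> hJ /T10P XJ /T10P YJ; exact: (eigen_null two (cgJ hJ) i2 XJ YJ).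
Qed.

(** The vectors [v a] = e_a - i J e_a lie in [N], and the real part of [h] on two of them is h(e_a,
    e_b) - h(J e_a, J e_b). What results is a real tensor identity, which can be differentiated. *)
Lemma T10_invariant (h : 'M[R]_4) x : U x ->
  (forall X Y, (X <= T10 (J x))%MS -> (Y <= T10 (J x))%MS ->
     bil (cmx h) X Y = 0) ->
  h = J x *m h *m (J x)^T.
Proof.
move=> Ux h0; pose v a : 'rV[R[i]]_4 := delta_mx 0 a *m (1%:M - 'i *: cmx (J x)).
have cJ2 : cmx (J x) *m cmx (J x) = - 1%:M.
  by rewrite /cmx -map_mxM J2// map_mxN map_mx1.
have vN a : (v a <= T10 (J x))%MS.
  apply/T10P; rewrite -mulmxA scalemxAr; congr (_ *m _).
  by rewrite mulmxBl mul1mx -scalemxAl cJ2 scalerBr scalerA i2 scalerN scaleN1r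
    !opprK addrC.
apply/matrixP => a b; have := h0 _ _ (vN a) (vN b).
have -> : bil (cmx h) (v a) (v b) =
    (cmx (h - J x *m h *m (J x)^T)
     - 'i *: cmx (J x *m h + h *m (J x)^T)) a b.
  have -> : bil (cmx h) (v a) (v b) =
    ((1%:M - 'i *: cmx (J x)) *m cmx h *m (1%:M - 'i *: cmx (J x))^T) a b.
    rewrite /bil /v trmx_mul trmx_delta !mulmxA -colE -!mulmxA -rowE.
    by rewrite mxE mxE !mulmxA.
  congr (fun_of_matrix _ a b).
  have expand (c : R[i]) (u w h' : 'M[R[i]]_4) :
      (1%:M - c *: u) *m h' *m (1%:M - c *: w) =
      h' + (c * c) *: (u *m h' *m w) - c *: (u *m h' + h' *m w) by mxlinear.
  have -> : (1%:M - 'i *: cmx (J x))^T = 1%:M - 'i *: (cmx (J x))^T.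
    by rewrite linearB /= linearZ /= trmx1.
  rewrite expand i2 scaleN1r /cmx map_mxB map_mxD.
  by rewrite (map_mxM _ _ (J x)^T) (map_mxM _ (J x)) (map_mxM _ h) matrix.map_trmx.
rewrite !linmxE !mxE => /eqP; rewrite eq_complex /= => /andP[/eqP + _].
rewrite !(mul0r, mul1r, mulr0, subr0, add0r, oppr0, addr0).
by move=> /eqP; rewrite subr_eq0 => /eqP.
Qed.

Lemma T10_frame x : U x -> exists m p n k : 'rV[R[i]]_4,
  adapted_frame (g x) (T10 (J x)) m p n k.
Proof.
move=> Ux; apply: (@frame_exists _ two 'i i2 (cmx (g x)) (cmx (J x))).
- exact: cg_sym.
- by rewrite /cmx map_unitmx g_unit.
- by rewrite /cmx -map_mxM J2// map_mxN map_mx1.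
- exact/cgJ/gJ.
Qed.

Let ricC x X Y : ric (Rc x) X Y = bil (cmx (Ric x)) X Y.
Proof.
rewrite /ric; congr (bil _ X Y); apply/matrixP => b d; rewrite !mxE.
by rewrite ricciE rmorph_sum; apply: eq_bigr => c _; rewrite mxE.
Qed.

Lemma ricci_sym_invariant x : U x ->
  Ric x + (Ric x)^T = J x *m (Ric x + (Ric x)^T) *m (J x)^T.
Proof.
move=> Ux; apply: T10_invariant => // X Y XN YN.
have [m [p [n [k [[mp nk] [mm pp nn kk] [mn mk pn pk] N]]]]] := T10_frame Ux.
have := ric_skew two (cg_sym Ux) mp nk mm pp nn kk mn mk pn pk N
  (fun c d => curv_anti c d x) (curv_bianchi Ux) (curv_metric Ux)
  (curv_stable Ux) XN YN.
by rewrite !ricC /cmx map_mxD -matrix.map_trmx bil_addmx bil_trmx.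
Qed.

Let PE x : P x = 2^-1 *: Ric x - (12^-1 * scalar_curvature g G x) *: g x.
Proof. by apply/matrixP => a b; rewrite !mxE. Qed.

Let smooth_schouten : smooth_mx U P.
Proof.
have sgi := smooth_invmx openU g_unit sg.
have sR a b : smooth_on U (ricci G a b).
  by apply: smooth_on_sum => // c; exact: smooth_curvature.
have ss : smooth_on U (scalar_curvature g G).
  apply: smooth_on_sum => // a; apply: smooth_on_sum => // b.
  exact (smooth_onM openU (sgi a b) (sR a b)).
move=> a b.
apply: (smooth_on_congr openU (f := schouten g G a b)).
  by move=> y _; rewrite mxE.
apply: smooth_onB => //.
  by apply: smooth_onM => //; exact: smooth_on_cst.
apply: smooth_onM => //.
by apply: smooth_onM => //; exact: smooth_on_cst.
Qed.

Let schouten_sym_invariant x : U x ->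
  P x + (P x)^T = J x *m (P x + (P x)^T) *m (J x)^T.
Proof.
move=> Ux; set s := 12^-1 * scalar_curvature g G x.
have -> : P x + (P x)^T = 2^-1 *: (Ric x + (Ric x)^T) - (2 * s) *: g x.
  rewrite PE -/s linearB /= !linearZ /= g_sym//.
  by move: (Ric x)^T => Z; mxlinear.
rewrite mulmxBr mulmxBl -!scalemxAr -!scalemxAl gJ//.
by rewrite -ricci_sym_invariant.
Qed.

Let H x d c := cmx (cov2mx G d c P x).

(** The symmetric part of [P] is [J]-invariant on all of [U]. So is its second covariant derivative,
    which therefore vanishes on [N] by [T10_null]. *)
Let cov_schouten_skew x : U x -> forall X Y Z W,
  (X <= T10 (J x))%MS -> (Y <= T10 (J x))%MS ->
  bil (bext (H x) Z W) X Y = - bil (bext (H x) Z W) Y X.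
Proof.
move=> Ux X Y Z W XN YN; apply/eqP; rewrite -addr_eq0 !bil_bext -big_split.
apply/eqP; apply: big1 => d _; rewrite -big_split; apply: big1 => c _ /=.
rewrite -mulrDr -[X in _ + X]bil_trmx -bil_addmx.
have sPs : smooth_mx U (fun y => P y + (P y)^T).
  exact: (smooth_mxD openU smooth_schouten (smooth_mx_tr smooth_schouten)).
have := cov2mx_invariant openU sG sJ J_parallel d c sPs schouten_sym_invariant Ux.
rewrite (cov2mx_sym openU sG d c smooth_schouten Ux) => inv.
have := T10_null (esym inv) XN YN.
by rewrite /cmx map_mxD -matrix.map_trmx => ->; rewrite mulr0.
Qed.

Let eval_cotton x : U x -> forall X Y Z W,
  eval4C (fun d a b c => nabla3 G (cotton g G) d a b c x) X Y Z W =
  bil (bext (H x) X Z) W Y - bil (bext (H x) X W) Z Y.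
Proof.
move=> Ux X Y Z W.
have -> : (fun d a b c => nabla3 G (cotton g G) d a b c x) =
    (fun d a b c => cov2mx G d b P x c a - cov2mx G d c P x b a).
  apply/funext => d; apply/funext => a; apply/funext => b; apply/funext => c.
  exact: (nabla3_cotton openU sG).
rewrite eval4CB; congr (_ - _).
  rewrite eval4C_swap23 eval4C_swap34.
  exact: (eval4C_bext (fun d b => cov2mx G d b P x)).
rewrite eval4C_swap34 eval4C_swap23 eval4C_swap34.
exact: (eval4C_bext (fun d c => cov2mx G d c P x)).
Qed.

Lemma multiple_root_T10 x (m p n k : 'rV[R[i]]_4) : U x ->
  (forall X Y : 'rV[R[i]]_4,
     (X <= T10 (J x))%MS -> (Y <= T10 (J x))%MS ->
     eval4C (fun d a b c => nabla3 G (cotton g G) d a b c x) X Y X Y =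
     eval4C (fun d a b c => nabla3 G (cotton g G) d a b c x) Y X X Y) ->
  adapted_frame (g x) (T10 (J x)) m p n k ->
  multiple_root (principal_quartic (fun a b c d => weyl g a b c d x) m p n k) 0.
Proof.
move=> Ux cond [[mp nk] [mm pp nn kk] [mn mk pn pk] N].
have mN : (m <= T10 (J x))%MS.
  by rewrite -N -addsmxE addsmxSl.
have kN : (k <= T10 (J x))%MS.
  by rewrite -N -addsmxE addsmxSr.
have Hskew := cov_schouten_skew Ux.
have alt Z W X : (X <= T10 (J x))%MS -> bil (bext (H x) Z W) X X = 0.
  move=> XN; apply: (mulfI two); rewrite mulr0 mulr_natl mulr2n.
  by rewrite {1}Hskew// addNr.
have RP : bil (bext (Rc x) m k *m cmx (P x)
    + cmx (P x) *m (bext (Rc x) m k)^T) m k = 0.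
  have -> : bext (Rc x) m k *m cmx (P x) + cmx (P x) *m (bext (Rc x) m k)^T =
      bext (H x) k m - bext (H x) m k.
    rewrite /bext mulmx_suml raddf_sum mulmx_sumr -big_split.
    rewrite [X in _ = X - _]exchange_big -sumrB; apply: eq_bigr => c _ /=.
    rewrite mulmx_suml raddf_sum mulmx_sumr -big_split -sumrB.
    apply: eq_bigr => d _ /=.
    rewrite linearZ /= -scalemxAl -scalemxAr -scalerDr [k 0 d * _]mulrC -scalerBr.
    congr (_ *: _); rewrite /H /Rc /cmx matrix.map_trmx -!map_mxM -map_mxD -map_mxB.
    congr (map_mx _ _).
    have := cov2mx_commutator openU sG G_sym c d smooth_schouten Ux.
    by move=> /(congr1 -%R); rewrite opprB opprK => ->.
  (* The terms on (k, k) and (m, m) vanish, and skewness turns (k, m) into (m, k). The Cotton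
     condition thus says that both orders of differentiation of [P] agree on (m, k). *)
  have e1 := eval_cotton Ux m k m k; have e2 := eval_cotton Ux k m m k.
  have := etrans (esym e1) (etrans (cond m k mN kN) e2).
  rewrite (alt m m k kN) (alt k k m mN) (Hskew k m k m kN mN) sub0r subr0.
  move: (bext (H x) m k) (bext (H x) k m) => A A' /oppr_inj E.
  by rewrite bil_addmx bil_oppmx E subrr.
have f0 : bil (cmx (Fm x)) m k = 0.
  apply: (dform_vanishes two (cg_sym Ux) mp nk mm pp nn kk mn mk pn pk N
    (fun c d => curv_anti c d x) (curv_bianchi Ux) (curv_metric Ux)
    (curv_stable Ux) _ RP) => X Y XN YN.
  rewrite ricC PE /cmx map_mxB !map_mxZ bil_addmx bil_oppmx !bil_scalemx.
  (* [N] is null, so the scalar curvature part of [P] is invisible there and twice [P] is the Ricci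
     tensor. *)
  have -> : bil (map_mx (real_complex R) (g x)) X Y = 0.
    by apply: T10_null XN YN; exact: gJ.
  rewrite mulr0 subr0 mulrA /= fmorphV rmorph_nat.
  by rewrite mulfV// mul1r.
have [t [Q [WE QE]]] := weyl_decomposition openU sg sB sG g_sym g_unit G_sym
  G_weyl Ux.
have ev X Y Z W : eval4C (fun a b c d => weyl g a b c d x) X Y Z W =
    weyl_form (cmx (g x)) (Rc x) (cmx (Fm x)) (cmx Q) X Y Z W.
  apply: (eval4C_weyl (Rm := fun c d => curvmx G c d x) (f := Fm x)).
  move=> a b c d; have FE : Fm x c d = dform B c d x by rewrite mxE.
  by rewrite WE FE.
have QC X Y : 2 * bil (cmx Q) X Y = ric (Rc x) X Y
    - 2^-1 * bil (cmx (Fm x)) X Y - (t%:C) * bil (cmx (g x)) X Y.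
  have QM : 2 *: Q = Ric x - 2^-1 *: Fm x - t *: g x.
    by apply/matrixP => b d; rewrite !mxE QE.
  have := congr1 (fun A => bil (cmx A) X Y) QM.
  rewrite /cmx !map_mxB !map_mxZ !bil_addmx !bil_oppmx !bil_scalemx ricC.
  by rewrite /= !fmorphV !rmorph_nat.
have [W0 W1] := weyl_form_principal two (cg_sym Ux) mp nk mm pp nn kk mn mk pn pk N
  (fun c d => curv_anti c d x) (curv_bianchi Ux) (curv_metric Ux)
  (curv_stable Ux) (Fm_anti x) f0 QC.
by apply: quartic_double_root; rewrite !ev.
Qed.

End Chart.

(** * Nondegeneracy of the metric in both signatures *)

Section NondegenerateMetric.
Variable R : realType.

Lemma positive_definite_unit (A : 'M[R]_4) : positive_definite A -> A \in unitmx.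
Proof.
move=> pA; rewrite -row_free_unit -kermx_eq0; apply/negPn/negP => /rowV0Pn[v].
move=> /sub_kermxP vA v0; have := pA v v0.
by rewrite vA mul0mx mxE ltxx.
Qed.

Lemma split_signature_unit (A : 'M[R]_4) : split_signature A -> A \in unitmx.
Proof.
move=> [Q uQ QA].
have : Q *m A *m Q^T \in unitmx.
  rewrite QA unitmxE det_diag unitfE; apply/prodf_neq0 => i _.
  by rewrite mxE; case: ifP; rewrite ?oppr_eq0 oner_eq0.
by rewrite unitmx_mul => /andP[]; rewrite unitmx_mul => /andP[].
Qed.

End NondegenerateMetric.

Theorem theorem7p16 (R : realType) (M : manifold4 R)
    (g : pseudo_metric M) (J : complex_structure M) (gJ : hermitian_metric g J)
    (o : orientation M)
    (N_selfdual : forall i x, cimg (atlas i) x ->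
      selfdual (g i x) (o i x) (T10 (J i x)))
    (D : connection M) (D_weyl : hermitian_weyl g J D)
    (D_cotton : forall i x, cimg (atlas i) x ->
      let DA := fun d a b c : 'I_4 => nabla3 (D i) (cotton (g i) (D i)) d a b c x in
      forall X Y : 'rV[R[i]]_4,
        (X <= T10 (J i x))%MS -> (Y <= T10 (J i x))%MS ->
        eval4C DA X Y X Y = eval4C DA Y X X Y) :
  forall (q : M) (i : chart_index M), cdom (atlas i) q ->
    let x := cmap (atlas i) q in
    let C := fun a b c d : 'I_4 => weyl (g i) a b c d x in
    algebraically_special (g i x) (o i x) C (T10 (J i x)) /\
    multiple_principal (g i x) (o i x) C (T10 (J i x)) (T10 (J i x)).
Proof.
move=> q i dq x C.
(* [N] itself is the special plane, so the second claim implies the first. *)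
suff P : multiple_principal (g i x) (o i x) C (T10 (J i x)) (T10 (J i x)).
  by split=> //; exists (T10 (J i x)).
have Ux : cimg (atlas i) x by exact: cmap_in.
have openU : open (cimg (atlas i)) by exact: cimg_open.
have [D_sym J_par [B DB]] := D_weyl.
have g_unit y : cimg (atlas i) y -> g i y \in unitmx.
  move=> Uy; have [pos|spl] := metric_signature g.
    exact: positive_definite_unit (pos i y Uy).
  exact: split_signature_unit (spl i y Uy).
have G_weyl y : cimg (atlas i) y -> forall c,
    cov2 (D i) c (g i) y = - B i y 0 c *: g i y.
  move=> Uy c; apply/matrixP => a b.
  have gE : g i = (fun z => \matrix_(a, b) g i z a b).
    by apply/funext => z; apply/matrixP => a' b'; rewrite mxE.
  rewrite [in LHS]gE -(nabla2E (D i) (fun a b z => g i z a b)) DB//.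
  by rewrite [RHS]scalemxE.
have sg : smooth_mx (cimg (atlas i)) (g i) by exact: metric_smooth.
have sJ : smooth_mx (cimg (atlas i)) (J i) by exact: cs_smooth.
have sB : smooth_mx (cimg (atlas i)) (B i) by exact: form_smooth.
have sD a b c : smooth_on (cimg (atlas i)) (D i a b c) by exact: conn_smooth.
have g_sym y : cimg (atlas i) y -> (g i y)^T = g i y by exact: Defs.metric_sym.
have J2 y : cimg (atlas i) y -> J i y *m J i y = - 1%:M by exact: cs_square.
have null X Y : (X <= T10 (J i x))%MS -> (Y <= T10 (J i x))%MS ->
    cform (g i x) X Y = 0.
  by move=> XN YN; apply: (T10_null (J := J i)) XN YN; exact: gJ.
split; [exact: null|exact: N_selfdual| |].
  have [m [p [n [k mpnk]]]] := T10_frame g_sym g_unit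
    J2 (gJ i) Ux.
  exists m, p, n, k, 0; split=> //; rewrite !scale0r addr0 subr0.
  by case: mpnk.
move=> m p n k z mpnk mzN.
(* A frame could a priori describe [N] with another parameter; but m + z n and k both lie in the
   null plane [N], and their product is [z]. *)
have z0 : z = 0.
  have [[_ nk] _ [_ mk _ _] mkN] := mpnk.
  have m'N : ((m + z *: n)%R <= T10 (J i x))%MS.
    by rewrite -mzN -addsmxE addsmxSl.
  have kN : (k <= T10 (J i x))%MS.
    by rewrite -mkN -addsmxE addsmxSr.
  have := null _ _ m'N kN; rewrite [cform _ _ _]bilDl bilZl.
  by rewrite [bil _ m k]mk [bil _ n k]nk add0r mulr1.
rewrite z0; apply: (multiple_root_T10 openU sg sB sJ sD g_sym
  g_unit J2 (gJ i) (D_sym i) G_weyl (J_par i) Ux) => //.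
exact: D_cotton.
Qed.
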